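(* Let $0<\alpha<1$, let $k\ge 1$ be an integer, and let $\lambda_1,\dots,\lambda_k>0$. Then the generalized fractional counting process (GFCP) $\{M^{\alpha}(t)\}_{t\ge0}$ with these parameters exhibits the long-range dependence (LRD) property.
   Context: The generalized fractional counting process (GFCP) is $M^\alpha(t)=M(Y_\alpha(t))$, $t\ge0$, $0<\alpha<1$, where: $\{M(t)\}_{t\ge0}$ (the generalized counting process) is the compound Poisson process with jumps of sizes $1,\dots,k$ occurring at rates $\lambda_1,\dots,\lambda_k$ respectively, i.e. the Lévy process $M(t)=\sum_{i=1}^{N(t)}X_i$ with $\{N(t)\}_{t\ge0}$ a Poisson process of intensity $\Lambda=\lambda_1+\dots+\lambda_k$ independent of the iid sequence $\{X_i\}_{i\ge1}$, $\mathrm{Pr}\{X_1=j\}=\lambda_j/\Lambda$, $j=1,\dots,k$; and $\{Y_\alpha(t)\}_{t\ge0}$ is the inverse $\alpha$-stable subordinator, independent of $\{M(t)\}_{t\ge0}$: $Y_\alpha(t)=\inf\{x>0: D_\alpha(x)>t\}$, with $\{D_\alpha(t)\}_{t\ge0}$ the non-decreasing Lévy process satisfying $\mathbb{E}(e^{-sD_\alpha(t)})=e^{-ts^\alpha}$, $s>0$. Definition (LRD/SRD). Suppose a stochastic process $\{X(t)\}_{t\ge0}$ is such that, for fixed $s>0$ (arbitrary), its correlation function satisfies $$\operatorname{Corr}(X(s),X(t))\sim c(s)t^{-\theta}\quad\text{as } t\to\infty$$ for some $c(s)>0$, with $\theta$ not depending on $s$. The process is said to exhibit the LRD property if $\theta\in(0,1)$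 and the short-range dependence (SRD) property if $\theta\in(1,2)$. Here $f(t)\sim g(t)$ means $f(t)/g(t)\to1$. *)

(* Defs.v *)
From HB Require Import structures.
From mathcomp Require Import all_boot all_order all_algebra.
From mathcomp Require Import all_classical all_reals all_analysis.

Set Implicit Arguments.
Unset Strict Implicit.
Unset Printing Implicit Defensive.

Import Order.TTheory GRing.Theory Num.Theory.
Import numFieldNormedType.Exports.

Local Open Scope classical_set_scope.
Local Open Scope ring_scope.

(* Processes {X(t)}_{t >= 0} are functions X : R -> T -> T' of which only the
   values at times t >= 0 matter. Path properties are required almost surely. *)

Section independence.
Context d (T : measurableType d) (R : realType) (P : probability T R).

Definition mutually_independent (I : choiceType) d' (T' : measurableType d')
    (X : I -> T -> T') : Prop :=
  forall (J : seq I) (B : I -> set T'), uniq J -> (forall i, measurable (B i)) ->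
    (P (\bigcap_(i in [set` J]) (X i @^-1` B i))
       = \prod_(i <- J) P (X i @^-1` B i))%E.

Definition generated_sigma (I : Type) (D : set I) d' (T' : measurableType d')
    (X : I -> T -> T') : set (set T) :=
  <<s \bigcup_(i in D) preimage_set_system setT (X i) measurable >>.

Definition independent_families
    (I : Type) (D : set I) d1 (T1 : measurableType d1) (X : I -> T -> T1)
    (J : Type) (E : set J) d2 (T2 : measurableType d2) (Y : J -> T -> T2) : Prop :=
  forall A B : set T, generated_sigma D X A -> generated_sigma E Y B ->
    (P (A `&` B) = P A * P B)%E.

End independence.

Section processes.
Context d (T : measurableType d) (R : realType) (P : probability T R).

Definition times : set R := [set t | 0 <= t].

Definition stochastic_process d' (T' : measurableType d') (X : R -> T -> T') :
    Prop :=
  forall t : R, 0 <= t -> measurable_fun setT (X t).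

Definition cadlag (x : R -> R) : Prop :=
  (forall t : R, 0 <= t -> x u @[u --> t^'+] --> x t) /\
  (forall t : R, 0 < t -> cvg (x u @[u --> t^'-])).

Definition independent_increments (X : R -> T -> R) : Prop :=
  forall t : nat -> R, 0 <= t 0%N -> (forall n, t n <= t n.+1) ->
    mutually_independent P (fun n w => X (t n.+1) w - X (t n) w).

Definition stationary_increments (X : R -> T -> R) : Prop :=
  forall (s t : R) (B : set R), 0 <= s -> 0 <= t -> measurable B ->
    P [set w | B (X (s + t) w - X s w)] = P [set w | B (X t w)].

Definition Levy_process (X : R -> T -> R) : Prop :=
  [/\ stochastic_process X,
      {ae P, forall w, X 0 w = 0},
      independent_increments X,
      stationary_increments X &
      {ae P, forall w, cadlag (X ^~ w)}].

(* The law is only prescribed for t > 0 because [poisson_pmf 0] is not the pmf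
   of the Poisson distribution of parameter 0; N(0) = 0 is part of being a
   Levy process. *)
Definition Poisson_process (rate : R) (N : R -> T -> nat) : Prop :=
  [/\ stochastic_process N,
      Levy_process (fun t w => (N t w)%:R) &
      forall (t : R) (n : nat), 0 < t -> P [set w | N t w = n] = (poisson_pmf (rate * t) n)%:E].

Section counting.
Variables (k : nat) (lam : 'I_k -> R).

Definition total_rate : R := \sum_(j < k) lam j.

(* The index j : 'I_k stands for the jump size j + 1. *)
Definition iid_jumps (X : nat -> T -> nat) : Prop :=
  [/\ forall i, measurable_fun setT (X i),
      mutually_independent P X &
      forall i (j : 'I_k), P [set w | X i w = j.+1] = (lam j / total_rate)%:E].

Definition compound (N : R -> T -> nat) (X : nat -> T -> nat) (t : R) (w : T) : R :=
  (\sum_(i < N t w) X i w)%N%:R.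

Definition GCP (M : R -> T -> R) : Prop :=
  exists (N : R -> T -> nat) (X : nat -> T -> nat),
    [/\ Poisson_process total_rate N,
        iid_jumps X,
        independent_families P times N setT X &
        M = compound N X].

End counting.

Definition stable_subordinator (alpha : R) (D : R -> T -> R) : Prop :=
  [/\ Levy_process D,
      {ae P, forall w, forall s t : R, 0 <= s -> s <= t -> D s w <= D t w} &
      forall s t : R, 0 < s -> 0 <= t ->
        ('E_P[fun w => expR (- s * D t w)] = (expR (- t * s `^ alpha))%:E)%E].

(* Y is measurable and indistinguishable from the first-passage process of D.
   The infimum is of a nonempty set almost surely, so the value of [inf] on the
   empty set is irrelevant. *)
Definition inverse_stable_subordinator (alpha : R) (Y : R -> T -> R) : Prop :=
  stochastic_process Y /\
  exists2 D : R -> T -> R, stable_subordinator alpha D &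
    {ae P, forall w, forall t : R, 0 <= t ->
      Y t w = inf [set x | 0 < x /\ t < D x w]}.

(* As above, the defining equation M^alpha(t) = M(Y_alpha(t)) holds up to
   indistinguishability. *)
Definition GFCP (alpha : R) (k : nat) (lam : 'I_k -> R) (Z : R -> T -> R) : Prop :=
  stochastic_process Z /\
  exists M Y : R -> T -> R,
    [/\ GCP lam M,
        inverse_stable_subordinator alpha Y,
        independent_families P times M times Y &
        {ae P, forall w, forall t : R, 0 <= t -> Z t w = M (Y t w) w}].

(* For measurable X and Y, this is 0 whenever a variance is zero or infinite, so
   the asymptotics required below force the correlations involved to be genuine. *)
Definition correlation (X Y : T -> R) : R :=
  fine (covariance P X Y) /
    (Num.sqrt (fine 'V_P[X]) * Num.sqrt (fine 'V_P[Y])).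

Definition correlation_decay (theta : R) (X : R -> T -> R) : Prop :=
  forall s : R, 0 < s -> exists2 c : R, 0 < c &
    correlation (X s) (X t) / (c * t `^ (- theta)) @[t --> +oo] --> (1 : R).

Definition LRD (X : R -> T -> R) : Prop :=
  exists theta : R, 0 < theta < 1 /\ correlation_decay theta X.

End processes.

(* Main.v *)
Require Import Defs.
From HB Require Import structures.
From mathcomp Require Import all_boot all_order all_algebra.
From mathcomp Require Import all_classical all_reals all_analysis.
From mathcomp Require Import measurable_realfun ring lra.
Import Order.TTheory GRing.Theory Num.Theory.
Import numFieldNormedType.Exports.
Local Open Scope classical_set_scope.
Local Open Scope ring_scope.

(** The correlation exponent is [alpha]. Write [Z] for the process, that is [M] run
    at the random time [Y t], where [Y] is the first-passage process of the
    subordinator [D]; let [m] and [m2] be the mean and the variance of [M 1].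

    _Reduction to [Y]._ Conditionally on [Y], the moments of [M] give
    [E Z(t) = m E Y(t)] and, for [s <= t],
    [E Z(s) Z(t) = m2 E Y(s) + m^2 E Y(s) Y(t)] ([GFCP_mean],
    [GFCP_mean_mul]). As only the independence of the two families is given, the
    conditioning is done on the rounded times, for which it is a countable sum
    ([expectation_random_index]); the almost sure monotonicity of [M] sandwiches
    [Z] between the two roundings ([subordination_mean]). The moments of [M]
    come in the same way from those of a Poisson process and of sums of
    independent jumps ([compound_mean_mul]).

    _Variance._ Comparing Laplace transforms, [D x / t] has the law of
    [D (x / t^alpha)] ([laplace_uniqueness], [below_scaling]). Since [x < Y t] and
    [D x <= t] are the same event up to [x = Y t], the moments of [Y t] are those
    of [t^alpha Y 1]. Moreover [Y 1] is square integrable and not constant,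
    because [D x <= 1] has positive probability for every [x]
    ([inverse_variance_gt0]). So the variance of [Z t] is equivalent to
    [m^2 Var(Y 1) t^(2 alpha)].

    _Covariance._ When [Y s] passes [x], the subordinator restarts afresh from a
    level between 0 and [s]; what [Y t] gains after [x] thus lies between
    independent copies of [Y (t - s)] and of [Y t]. Integrating over [x],
    [E Y(s) Y(t) - E Y(s) E Y(t)] lies between [j - E Y(s) (E Y(t) - E Y(t-s))]
    and [j], where [j] is half the second moment of [Y s]
    ([inverse_mul_bounds]). As [E Y(t)] is proportional to [t^alpha] with
    [alpha < 1], its increments over a fixed length tend to 0, and the covariance
    of [Z s] and [Z t] converges to [m2 E Y(s) + m^2 j > 0]. Dividing by the
    standard deviations leaves a positive constant times [t^(- alpha)].

    Expectations are handled through the layer-cake formula ([layer_cake]), in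
    which strict and weak inequalities are interchangeable. *)

(** * Layer-cake formulas *)

Section layer_cake.
Set Implicit Arguments.
Unset Strict Implicit.
Context d (T : measurableType d) (R : realType) (P : probability T R).
Local Notation mu := (@lebesgue_measure R).
Local Open Scope ereal_scope.

Lemma measurable_natb d' (S : measurableType d') (p : S -> bool) :
  measurable_fun setT p -> measurable_fun setT (fun x => (p x)%:R : R).
Proof.
move=> mp.
rewrite (_ : (fun _ => _) = (fun x => if p x then 1 else 0)%R); last first.
  by apply/funext => x; case: (p x).
exact: measurable_fun_ifT.
Qed.

Lemma measurable_lteif d' (S : measurableType d') b (f g : S -> R) :
  measurable_fun setT f -> measurable_fun setT g ->
  measurable_fun setT (fun x => (f x < g x ?<= if b)%R).
Proof.
move=> mf mg; case: b => /=.
  exact: measurable_fun_ler.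
exact: measurable_fun_ltr.
Qed.

(** [B w] is the length of the interval between 0 and [B w], so Tonelli's theorem
    turns the expectation of [f B] into an integral of expectations of [f] cut by
    events. The length does not see the right endpoint of the interval, whence the
    free choice [b] between strict and weak inequalities; comparing one with the
    other replaces any discussion of atoms below. *)
Lemma layer_cake b (f : T -> \bar R) (B : T -> R) :
  measurable_fun setT f -> (forall w, 0 <= f w) ->
  measurable_fun setT B -> {ae P, forall w, (0 <= B w)%R} ->
  \int[P]_w (f w * (B w)%:E) =
  \int[mu]_(x in `[0%R, +oo[)
     \int[P]_w (f w * ((x < B w ?<= if b)%R)%:R%:E).
Proof.
move=> mf f0 mB B0.
pose g (p : T * measurableTypeR R) : \bar R :=
  f p.1 * ((0 <= p.2)%R && (p.2 < B p.1 ?<= if b)%R)%:R%:E.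
have g0 p : 0 <= g p by rewrite mule_ge0.
have mg : measurable_fun setT g.
  apply: emeasurable_funM; first exact: measurableT_comp.
  apply/measurable_EFinP/measurable_natb/measurable_and.
    exact: measurable_fun_ler.
  by apply: measurable_lteif => //; exact: measurableT_comp.
have swap := @fubini_tonelli _ _ T (measurableTypeR R) R P mu g mg g0.
apply: (etrans _ (etrans swap _)); last first.
  rewrite [RHS]integral_mkcond.
  apply: eq_integral => x _; rewrite patchE /g/=.
  have [x0|x0] := leP 0%R x; first by rewrite mem_set//= in_itv/= x0.
  rewrite memNset/= ?in_itv/= ?leNgt ?x0//.
  by apply: integral0_eq => w _; rewrite mule0.
apply: ae_eq_integral => //.
- exact/emeasurable_funM/measurable_EFinP.
- exact: (@measurable_fun_fubini_tonelli_F _ _ T (measurableTypeR R) R mu g).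
apply: filterS B0 => w Bw _; rewrite /g/=.
under eq_integral do rewrite /=.
rewrite ge0_integralZl//; last by apply/measurable_EFinP/measurable_natb/measurable_and;
  [exact: measurable_fun_ler|exact: measurable_lteif].
congr (_ * _).
transitivity (\int[mu]_x (\1_[set` Interval (BLeft 0%R) (BSide (~~ b) (B w))] x)%:E).
  rewrite integral_indic// setIT; apply/esym/(etrans (lebesgue_measure_itv _)).
  rewrite /= lte_fin.
  by case: ltP => h; [rewrite oppr0 adde0|congr EFin; apply/eqP; rewrite eq_le Bw h].
apply: eq_integral => x _; rewrite indicE; congr (_%:R%:E).
by rewrite mem_setE itv_boundlr /= !bnd_simp; case: (b).
Qed.

End layer_cake.

Section layer_cake_sets.
Set Implicit Arguments.
Unset Strict Implicit.
Context d (T : measurableType d) (R : realType) (P : probability T R).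
Local Notation mu := (@lebesgue_measure R).
Local Open Scope ereal_scope.
Implicit Types (A B : T -> R) (b c : bool) (C : set T).

Definition above b B (x : R) : set T := [set w | (x < B w ?<= if b)%R].

Lemma measurable_above b B x : measurable_fun setT B -> measurable (above b B x).
Proof.
move=> mB; have : measurable_fun setT (fun w => (x < B w ?<= if b)%R).
  exact: measurable_lteif.
by move=> /(_ measurableT [set true] I); rewrite setTI.
Qed.

Lemma measurable_layer b (f : T -> \bar R) B :
  measurable_fun setT f -> (forall w, 0 <= f w) -> measurable_fun setT B ->
  measurable_fun setT
    (fun x : R => \int[P]_w (f w * ((x < B w ?<= if b)%R)%:R%:E)).
Proof.
move=> mf f0 mB.
pose g (p : T * measurableTypeR R) : \bar R :=
  f p.1 * ((p.2 < B p.1 ?<= if b)%R)%:R%:E.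
have g0 p : 0 <= g p by rewrite mule_ge0.
have mg : measurable_fun setT g.
  apply: emeasurable_funM; first exact: measurableT_comp.
  by apply/measurable_EFinP/measurable_natb/measurable_lteif => //;
    exact: measurableT_comp.
exact: (@measurable_fun_fubini_tonelli_G _ _ T (measurableTypeR R) R P g).
Qed.

Lemma layer_above b B C x : measurable C -> measurable_fun setT B ->
  \int[P]_w ((\1_C w)%:E * ((x < B w ?<= if b)%R)%:R%:E) = P (C `&` above b B x).
Proof.
move=> mC mB; rewrite -[in RHS](setIT (C `&` above b B x)) -integral_indic//; last first.
  by apply: measurableI => //; exact: measurable_above.
apply: eq_integral => w _; rewrite -EFinM !indicE in_setI -mulnb natrM; congr (_ * _)%:E.
by congr (nat_of_bool _)%:R; apply/idP/idP; rewrite inE.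
Qed.

Lemma measurable_P_above b B C : measurable C -> measurable_fun setT B ->
  measurable_fun setT (fun x : R => P (C `&` above b B x)).
Proof.
move=> mC mB; under eq_fun do rewrite -layer_above//.
by apply: measurable_layer => //; first exact/measurable_EFinP.
Qed.

Lemma layer_cake_indic b B C : measurable C ->
  measurable_fun setT B -> {ae P, forall w, (0 <= B w)%R} ->
  \int[P]_w ((\1_C w)%:E * (B w)%:E) =
  \int[mu]_(x in `[0%R, +oo[) P (C `&` above b B x).
Proof.
move=> mC mB B0; rewrite (layer_cake b)//; last exact/measurable_EFinP.
by apply: eq_integral => x _; rewrite layer_above.
Qed.

Lemma layer_cake1 b B :
  measurable_fun setT B -> {ae P, forall w, (0 <= B w)%R} ->
  \int[P]_w (B w)%:E = \int[mu]_(x in `[0%R, +oo[) P (above b B x).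
Proof.
move=> mB B0; have := layer_cake_indic b (@measurableT _ T) mB B0.
under eq_integral do rewrite indicT mul1e.
by move=> ->; apply: eq_integral => x _; rewrite setTI.
Qed.

Lemma measurable_P_above1 b B : measurable_fun setT B ->
  measurable_fun setT (fun x : R => P (above b B x)).
Proof.
move=> /(measurable_P_above b (@measurableT _ T)).
by under eq_fun do rewrite setTI.
Qed.

Lemma layer_cake_mul b A B :
  measurable_fun setT A -> {ae P, forall w, (0 <= A w)%R} ->
  measurable_fun setT B -> {ae P, forall w, (0 <= B w)%R} ->
  \int[P]_w (A w * B w)%:E =
  \int[mu]_(x in `[0%R, +oo[) \int[P]_w ((\1_(above b A x) w)%:E * (B w)%:E).
Proof.
move=> mA A0 mB B0.
pose B' w := Num.max (B w) 0%R.
have mB' : measurable_fun setT B' by exact: measurable_maxr.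
have BB' : {ae P, forall w, B' w = B w}.
  by apply: filterS B0 => w; rewrite /B'; case: ltgtP.
transitivity (\int[P]_w ((B' w)%:E * (A w)%:E)).
  apply: ae_eq_integral => //.
  - exact/measurable_EFinP/measurable_funM.
  - by apply: emeasurable_funM; exact/measurable_EFinP.
  - by apply: filterS BB' => w -> _; rewrite mulrC EFinM.
rewrite (layer_cake b)//; last 2 first.
  exact/measurable_EFinP.
  by move=> w; rewrite lee_fin /B' le_max lexx orbT.
apply: eq_integral => x _.
have mx : measurable (above b A x) by exact: measurable_above.
apply: ae_eq_integral => //.
- apply: emeasurable_funM; first exact/measurable_EFinP.
  exact/measurable_EFinP/measurable_natb/measurable_lteif.
- by apply: emeasurable_funM; exact/measurable_EFinP.
- apply: filterS BB' => w -> _; rewrite muleC indicE; congr (_%:R%:E * _).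
  by congr nat_of_bool; apply/idP/idP; rewrite inE.
Qed.

Lemma measurable_cut b A B :
  measurable_fun setT A ->
  measurable_fun setT B -> {ae P, forall w, (0 <= B w)%R} ->
  measurable_fun setT
    (fun x : R => \int[P]_w ((\1_(above b A x) w)%:E * (B w)%:E)).
Proof.
move=> mA mB B0.
pose B' w := Num.max (B w) 0%R.
have mB' : measurable_fun setT B' by exact: measurable_maxr.
have BB' : {ae P, forall w, B' w = B w}.
  by apply: filterS B0 => w; rewrite /B'; case: ltgtP.
rewrite [X in measurable_fun _ X](_ : _ = (fun x =>
    \int[P]_w ((B' w)%:E * ((x < A w ?<= if b)%R)%:R%:E))).
  apply: measurable_layer => //; first exact/measurable_EFinP.
  by move=> w; rewrite lee_fin /B' le_max lexx orbT.
apply/funext => x.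
have mx : measurable (above b A x) by exact: measurable_above.
apply: ae_eq_integral => //.
- by apply: emeasurable_funM; exact/measurable_EFinP.
- apply: emeasurable_funM; first exact/measurable_EFinP.
  exact/measurable_EFinP/measurable_natb/measurable_lteif.
- apply: filterS BB' => w -> _; rewrite muleC indicE; congr (_ * _%:R%:E).
  by congr nat_of_bool; apply/idP/idP; rewrite inE.
Qed.

(** The two sides may use different kinds of inequality, so inclusions of events
    that hold up to boundary cases are enough. *)
Lemma le_expectation_of_above b c A B :
  measurable_fun setT A -> {ae P, forall w, (0 <= A w)%R} ->
  measurable_fun setT B -> {ae P, forall w, (0 <= B w)%R} ->
  (forall x, (0 <= x)%R -> P (above b A x) <= P (above c B x)) ->
  \int[P]_w (A w)%:E <= \int[P]_w (B w)%:E.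
Proof.
move=> mA A0 mB B0 AB; rewrite (layer_cake1 b mA A0) (layer_cake1 c mB B0).
apply: ge0_le_integral => //; do ?by apply: measurable_funTS; exact: measurable_P_above1.
by move=> x; rewrite /= in_itv/= andbT; exact: AB.
Qed.

Lemma le_expectation_mul_of_above b c A B A' B' :
  measurable_fun setT A -> {ae P, forall w, (0 <= A w)%R} ->
  measurable_fun setT B -> {ae P, forall w, (0 <= B w)%R} ->
  measurable_fun setT A' -> {ae P, forall w, (0 <= A' w)%R} ->
  measurable_fun setT B' -> {ae P, forall w, (0 <= B' w)%R} ->
  (forall x y, (0 <= x)%R -> (0 <= y)%R ->
    P (above b A x `&` above b B y) <= P (above c A' x `&` above c B' y)) ->
  \int[P]_w (A w * B w)%:E <= \int[P]_w (A' w * B' w)%:E.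
Proof.
move=> mA A0 mB B0 mA' A'0 mB' B'0 AB.
rewrite (layer_cake_mul b mA A0 mB B0) (layer_cake_mul c mA' A'0 mB' B'0).
have pos b' (D E : T -> R) x : measurable_fun setT D -> measurable_fun setT E ->
    {ae P, forall w, (0 <= E w)%R} ->
    0 <= \int[P]_w ((\1_(above b' D x) w)%:E * (E w)%:E).
  by move=> mD mE E0; rewrite (layer_cake_indic b')//;
    [exact: integral_ge0|exact: measurable_above].
apply: ge0_le_integral => //.
- by move=> x _; exact: pos.
- by apply: measurable_funTS; exact: measurable_cut.
- by apply: measurable_funTS; exact: measurable_cut.
move=> x; rewrite /= in_itv/= andbT => x0.
rewrite (layer_cake_indic b)//; last exact: measurable_above.
rewrite (layer_cake_indic c)//; last exact: measurable_above.
apply: ge0_le_integral => //.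
- by apply: measurable_funTS; apply: measurable_P_above => //; exact: measurable_above.
- by apply: measurable_funTS; apply: measurable_P_above => //; exact: measurable_above.
by move=> y; rewrite /= in_itv/= andbT; exact: AB.
Qed.

Lemma expectation_mul_indic b A C :
  measurable C -> measurable_fun setT A -> {ae P, forall w, (0 <= A w)%R} ->
  (forall x, (0 <= x)%R -> P (C `&` above b A x) = P C * P (above b A x)) ->
  \int[P]_w ((\1_C w)%:E * (A w)%:E) = P C * \int[P]_w (A w)%:E.
Proof.
move=> mC mA A0 CA; rewrite (layer_cake_indic b)// (layer_cake1 b)//.
rewrite -ge0_integralZl//; last by apply: measurable_funTS; exact: measurable_P_above1.
by apply: eq_integral => x; rewrite inE/= in_itv/= andbT; exact: CA.
Qed.

Lemma expectation_mul_of_independent b A B :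
  measurable_fun setT A -> {ae P, forall w, (0 <= A w)%R} ->
  measurable_fun setT B -> {ae P, forall w, (0 <= B w)%R} ->
  (forall x y, (0 <= x)%R -> (0 <= y)%R ->
    P (above b A x `&` above b B y) = P (above b A x) * P (above b B y)) ->
  \int[P]_w (A w * B w)%:E = \int[P]_w (A w)%:E * \int[P]_w (B w)%:E.
Proof.
move=> mA A0 mB B0 AB; rewrite (layer_cake_mul b)//.
rewrite (layer_cake1 b mA A0) -ge0_integralZr//; last 2 first.
  by apply: measurable_funTS; exact: measurable_P_above1.
  by rewrite (layer_cake1 b)//; exact: integral_ge0.
apply: eq_integral => x; rewrite inE/= in_itv/= andbT => x0.
rewrite (@expectation_mul_indic b)//; first exact: measurable_above.
by move=> y y0; exact: AB.
Qed.

End layer_cake_sets.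

(** * Uniqueness of Laplace transforms *)

Section step_approximation.
Set Implicit Arguments.
Unset Strict Implicit.
Context d (T : measurableType d) (R : realType) (P : probability T R).

Lemma bernoulli_ineq (u : R) m : 0 <= u <= 1 -> 1 - m%:R * u <= (1 - u) ^+ m.
Proof.
move=> /andP[u0 u1]; elim: m => [|m IH]; first by rewrite mul0r subr0 expr0.
rewrite exprS; have v0 : 0 <= 1 - u by rewrite subr_ge0.
apply: le_trans (ler_wpM2l v0 IH).
rewrite -subr_ge0 [leRHS](_ : _ = m%:R * u ^+ 2); last by rewrite -natr1; ring.
by rewrite mulr_ge0// sqr_ge0.
Qed.

(** Square [1 + a / 2 <= exp (a / 2)]. *)
Lemma mulr_expRN_le (a : R) : 0 < a -> a * expR (- a) <= 4 / a.
Proof.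
move=> a0; have h : 1 + a / 2 <= expR (a / 2) by exact: expR_ge1Dx.
have e : expR a = expR (a / 2) ^+ 2 by rewrite expr2 -expRD; congr expR; field.
have : a ^+ 2 / 4 <= expR a.
  rewrite e; apply: le_trans (_ : (1 + a / 2) ^+ 2 <= _).
    by rewrite -subr_ge0 [leRHS](_ : _ = 1 + a); [lra|field].
  by rewrite lerXn2r// nnegrE; [lra|exact: expR_ge0].
move=> h2; rewrite expRN ler_pdivrMr ?expR_gt0// mulrAC ler_pdivlMr//.
by move: h2; rewrite expr2; lra.
Qed.

(** About [N exp (N t)] with [N = n + 1]: the exponent that makes
    [(1 - exp (- N x)) ^ m], as a function of [x], approach a step at [t]. *)
Definition step_exponent (t : R) (n : nat) : nat :=
  (Num.truncn (n.+1%:R * expR (n.+1%:R * t))).+1.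

(** The product of the exponent and [exp (- N x)] is of order
    [N exp (N (t - x))]: it tends to 0 if [t < x] and to infinity if [x <= t], the
    factor [N] in front settling the case [x = t]. *)
Lemma step_cvg (t x : R) : 0 <= t -> 0 <= x ->
  (1 - expR (- n.+1%:R * x)) ^+ step_exponent t n @[n --> \oo] -->
  ((t < x)%R%:R : R).
Proof.
move=> t0 x0.
have u01 n : 0 <= expR (- n.+1%:R * x) <= 1.
  by rewrite expR_ge0/= -expR0 ler_expR mulNr oppr_le0 mulr_ge0.
have le1 n m : 0 <= (1 - expR (- n.+1%:R * x)) ^+ m <= 1.
  have /andP[a b] := u01 n.
  by rewrite exprn_ge0 ?subr_ge0//= exprn_ile1 ?subr_ge0// gerBl.
have hc (c : R) : c * n.+1%:R^-1 @[n --> \oo] --> (0 : R).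
  by rewrite -(mulr0 c); apply: cvgM; [exact: cvg_cst|exact: cvg_harmonic].
have [tx|xt] := ltP t x.
- apply: (@squeeze_cvgr _ _ _ _
    (fun n => 1 - 8 / (x - t) ^+ 2 * n.+1%:R^-1) (fun=> 1)); last 2 first.
  + rewrite -[X in _ --> X](subr0 (1 : R)).
    by apply: cvgB; [exact: cvg_cst|exact: hc].
  + exact: cvg_cst.
  apply: nearW => n; have /andP[_ ->] := le1 n (step_exponent t n).
  rewrite andbT (le_trans _ (bernoulli_ineq _ (u01 n)))// lerD2l lerN2.
  set N : R := n.+1%:R; have N0 : 1 <= N by rewrite ler1n.
  have e1 : 1 <= expR (N * t) by rewrite -expR0 ler_expR mulr_ge0// (le_trans ler01).
  have : (step_exponent t n)%:R <= 2 * (N * expR (N * t)).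
    rewrite /step_exponent -natr1.
    have : (Num.truncn (N * expR (N * t)))%:R <= N * expR (N * t).
      by rewrite truncn_le// mulr_ge0// ?expR_ge0// (le_trans ler01).
    have : 1 <= N * expR (N * t) by rewrite mulr_ege1.
    lra.
  have v0 := expR_ge0 (- N * x).
  move/(ler_wpM2r v0)/le_trans; apply.
  have -> : 2 * (N * expR (N * t)) * expR (- N * x) =
      2 / (x - t) * (N * (x - t) * expR (- (N * (x - t)))).
    rewrite [in RHS](_ : - (N * (x - t)) = N * t + - N * x); last by ring.
    by rewrite expRD; field; rewrite subr_eq0 gt_eqF.
  have d0 : 0 < N * (x - t) by rewrite mulr_gt0 ?subr_gt0// (lt_le_trans ltr01).
  have c0 : 0 <= 2 / (x - t) by rewrite divr_ge0// subr_ge0 ltW.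
  apply: le_trans (ler_wpM2l c0 (mulr_expRN_le d0)) _.
  rewrite le_eqVlt; apply/orP; left; apply/eqP; field.
  by rewrite subr_eq0 !gt_eqF//; lra.
- apply: (@squeeze_cvgr _ _ _ _ (fun=> 0) (fun n => 1 * n.+1%:R^-1)); last 2 first.
  + exact: cvg_cst.
  + exact: hc.
  apply: nearW => n; have /andP[-> _] := le1 n (step_exponent t n) => /=.
  set N : R := n.+1%:R; have N0 : 1 <= N by rewrite ler1n.
  have /andP[a b] := u01 n.
  apply: (@le_trans _ _ (expR (- expR (- N * x)) ^+ step_exponent t n)).
    apply: lerXn2r; rewrite ?nnegrE ?subr_ge0 ?expR_ge0//.
    exact: expR_ge1Dx.
  rewrite -expRM_natl mul1r -lef_pV2 ?posrE ?invr_gt0 ?expR_gt0//.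
  rewrite invrK -expRN mulrN opprK.
  apply: le_trans (expR_ge1Dx _); apply: ler_wpDl => //.
  apply: (@le_trans _ _ (N * expR (N * t) * expR (- N * x))).
    rewrite -mulrA -expRD ler_peMr//.
    by rewrite -expR0 ler_expR mulNr -mulrBr mulr_ge0// subr_ge0.
  apply: ler_wpM2r => //; rewrite /step_exponent -/N.
  by rewrite ltW// truncnS_gt.
Qed.

End step_approximation.

Section laplace_uniqueness.
Set Implicit Arguments.
Unset Strict Implicit.
Context d (T : measurableType d) (R : realType) (P : probability T R).

Lemma integrable01 (f : T -> R) : measurable_fun setT f ->
  (forall w, 0 <= f w <= 1) -> P.-integrable setT (EFin \o f).
Proof.
move=> mf f01; apply: measurable_bounded_integrable => //.
  by rewrite (le_lt_trans (probability_le1 P measurableT))// ltry.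
exists 1; split => // M M1 w _; have /andP[f0 f1] := f01 w.
by rewrite /= ger0_norm// (le_trans f1)// ltW.
Qed.

(** Expanding [(1 - z) ^ m] shows that its expectation is a combination of
    moments; the extra factor [z ^ j] lets an induction on [m] replace the binomial
    formula. *)
Lemma expectation_power_1B (z z' : T -> R) :
  measurable_fun setT z -> measurable_fun setT z' ->
  (forall w, 0 <= z w <= 1) -> (forall w, 0 <= z' w <= 1) ->
  (forall j, \int[P]_w (z w ^+ j)%R%:E = \int[P]_w (z' w ^+ j)%R%:E)%E ->
  forall m j, (\int[P]_w ((1 - z w) ^+ m * z w ^+ j)%R%:E =
               \int[P]_w ((1 - z' w) ^+ m * z' w ^+ j)%R%:E)%E.
Proof.
move=> mz mz' z01 z'01 zz'; elim=> [|m IH] j.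
  under eq_integral do rewrite expr0 mul1r.
  by under [RHS]eq_integral do rewrite expr0 mul1r; exact: zz'.
have intg (y : T -> R) i : measurable_fun setT y -> (forall w, 0 <= y w <= 1) ->
    P.-integrable setT (EFin \o (fun w => (1 - y w) ^+ m * y w ^+ i)).
  move=> my y01; apply: integrable01.
    by apply: measurable_funM; apply: measurable_funX => //; exact: measurable_funB.
  move=> w; have /andP[a b] := y01 w.
  by rewrite mulr_ge0 ?exprn_ge0 ?subr_ge0//= mulr_ile1//
    ?exprn_ge0 ?exprn_ile1 ?subr_ge0// gerBl.
have step (y : T -> R) : measurable_fun setT y -> (forall w, 0 <= y w <= 1) ->
    (\int[P]_w ((1 - y w) ^+ m.+1 * y w ^+ j)%R%:E =
     \int[P]_w ((1 - y w) ^+ m * y w ^+ j)%R%:E -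
     \int[P]_w ((1 - y w) ^+ m * y w ^+ j.+1)%R%:E)%E.
  move=> my y01; rewrite -integralB_EFin//; do ?exact: intg.
  by apply: eq_integral => w _; rewrite -EFinB !exprS; congr EFin; ring.
by rewrite !step// !IH.
Qed.

Lemma cvg_step_expectation (X : T -> R) (t : R) : 0 <= t ->
  measurable_fun setT X -> (forall w, 0 <= X w) ->
  (\int[P]_w ((1 - expR (- n.+1%:R * X w)) ^+ step_exponent t n)%R%:E)%E
    @[n --> \oo] --> P (above false X t).
Proof.
move=> t0 mX X0.
have mabove : measurable (above false X t) by exact: measurable_above.
rewrite [X in _ --> X](_ : _ = \int[P]_w ((t < X w)%R%:R)%R%:E)%E; last first.
  rewrite -[in LHS](setIT (above false X t)) -integral_indic//.
  apply: eq_integral => w _; rewrite indicE; congr (nat_of_bool _)%:R%:E.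
  by apply/idP/idP; rewrite inE.
have mf n : measurable_fun setT
    (fun w => (1 - expR (- n.+1%:R * X w)) ^+ step_exponent t n).
  apply/measurable_funX/measurable_funB => //.
  by apply: measurableT_comp => //; exact: measurable_funM.
have [] := @dominated_convergence _ T R P setT measurableT
  (fun n w => ((1 - expR (- n.+1%:R * X w)) ^+ step_exponent t n)%:E)
  (fun w => ((t < X w)%R%:R)%:E) (cst 1%E).
- by move=> n; exact/measurable_EFinP.
- apply/measurable_EFinP/measurable_natb; exact: measurable_fun_ltr.
- apply: aeW => w _; apply: cvg_EFin; first exact: nearW.
  exact: step_cvg.
- by apply: (@integrable01 (cst 1)) => // w; rewrite lexx ler01.
- apply: aeW => w n _; rewrite lee_fin.
  have v0 : 0 <= expR (- n.+1%:R * X w) by exact: expR_ge0.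
  have v1 : expR (- n.+1%:R * X w) <= 1.
    by rewrite -expR0 ler_expR mulNr oppr_le0 mulr_ge0.
  by rewrite ger0_norm ?exprn_ge0 ?exprn_ile1 ?subr_ge0// gerBl.
by [].
Qed.

Lemma ae_ge0_max (X : T -> R) : {ae P, forall w, 0 <= X w} ->
  {ae P, forall w, Num.max (X w) 0 = X w}.
Proof. by apply: filterS => w; case: ltgtP. Qed.

(** [(1 - exp (- N X)) ^ m] is a polynomial in [exp (- N X)], so its expectation
    is determined by the Laplace transform of [X]; with the exponents of [step_cvg]
    it converges to the probability of [t < X]. *)
Lemma laplace_uniqueness (X X' : T -> R) :
  measurable_fun setT X -> {ae P, forall w, 0 <= X w} ->
  measurable_fun setT X' -> {ae P, forall w, 0 <= X' w} ->
  (forall s : R, (0 < s)%R -> \int[P]_w (expR (- s * X w))%R%:E =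
                      \int[P]_w (expR (- s * X' w))%R%:E)%E ->
  forall t, 0 <= t -> P (above false X t) = P (above false X' t).
Proof.
move=> mX X0 mX' X'0 lap t t0.
pose Y w := Num.max (X w) 0; pose Y' w := Num.max (X' w) 0.
have mY : measurable_fun setT Y by exact: measurable_maxr.
have mY' : measurable_fun setT Y' by exact: measurable_maxr.
have Y0 w : 0 <= Y w by rewrite le_max lexx orbT.
have Y'0 w : 0 <= Y' w by rewrite le_max lexx orbT.
have aboveY (Z : T -> R) : above false Z t = above false (fun w => Num.max (Z w) 0) t.
  by apply/seteqP; split => w; rewrite /above/= lt_max (ltNge t 0) t0 orbF.
rewrite (aboveY X) (aboveY X').
have lapY (s : R) : 0 < s -> (\int[P]_w (expR (- s * Y w))%R%:E =
                        \int[P]_w (expR (- s * Y' w))%R%:E)%E.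
  move=> s0; have mE (Z : T -> R) : measurable_fun setT Z ->
      measurable_fun setT (fun w => (expR (- s * Z w))%R%:E).
    move=> mZ; apply/measurable_EFinP; apply: measurableT_comp => //.
    exact: measurable_funM.
  transitivity (\int[P]_w (expR (- s * X w))%R%:E)%E.
    apply: ae_eq_integral; [by []|exact: mE|exact: mE|].
    by apply: filterS (ae_ge0_max X0) => w; rewrite /Y => ->.
  rewrite lap//; apply: ae_eq_integral; [by []|exact: mE|exact: mE|].
  by apply: filterS (ae_ge0_max X'0) => w; rewrite /Y' => ->.
have e1 := cvg_step_expectation t0 mY Y0.
have e2 := cvg_step_expectation t0 mY' Y'0.
suff E n : (\int[P]_w ((1 - expR (- n.+1%:R * Y w)) ^+ step_exponent t n)%R%:E =
            \int[P]_w ((1 - expR (- n.+1%:R * Y' w)) ^+ step_exponent t n)%R%:E)%E.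
  by move: e1; rewrite (funext E) => e1; exact: cvg_unique e1 e2.
have mz (Z : T -> R) : measurable_fun setT Z ->
    measurable_fun setT (fun w => expR (- n.+1%:R * Z w)).
  by move=> mZ; apply: measurableT_comp => //; exact: measurable_funM.
have z01 (Z : T -> R) w : (forall w, 0 <= Z w) -> 0 <= expR (- n.+1%:R * Z w) <= 1.
  by move=> Z0; rewrite expR_ge0/= -expR0 ler_expR mulNr oppr_le0 mulr_ge0.
have mom j : (\int[P]_w (expR (- n.+1%:R * Y w) ^+ j)%R%:E =
              \int[P]_w (expR (- n.+1%:R * Y' w) ^+ j)%R%:E)%E.
  case: j => [|j]; first by under eq_integral do rewrite expr0.
  under eq_integral do rewrite -expRM_natl mulrA.
  under [RHS]eq_integral do rewrite -expRM_natl mulrA.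
  by rewrite mulrN lapY// mulr_gt0.
have := @expectation_power_1B _ _ (mz _ mY) (mz _ mY')
  (fun w => z01 _ w Y0) (fun w => z01 _ w Y'0) mom (step_exponent t n) 0%N.
by move=> h; apply: etrans (etrans _ h) _; apply: eq_integral => w _; rewrite expr0 mulr1.
Qed.

End laplace_uniqueness.

(** * Random indices and generated sigma-algebras *)

Section random_index.
Set Implicit Arguments.
Unset Strict Implicit.
Context d (T : measurableType d) (R : realType) (P : probability T R).
Local Open Scope ereal_scope.

Section countable_partition.
Context (I : countType) (W : T -> I).
Hypothesis mW : forall i, measurable [set w | W w = i].

(** [pickle_inv] is injective where it is defined, unlike [unpickle]; this makes
    the pieces disjoint. *)
Let piece (n : nat) : set T := if pickle_inv n is Some i then [set w | W w = i] else set0.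

Let mpiece n : measurable (piece n).
Proof. by rewrite /piece; case: pickle_inv. Qed.

Let piece_partition : \bigcup_n piece n = setT.
Proof.
by apply/seteqP; split => // w _; exists (pickle (W w)) => //; rewrite /piece pickleK_inv.
Qed.

Let piece_trivIset : trivIset setT piece.
Proof.
move=> m n _ _ [w []]; rewrite /piece.
have := @pickle_invK I m; have := @pickle_invK I n.
by case: pickle_inv => // i; case: pickle_inv => // j /= <- <- -> ->.
Qed.

Lemma measurable_random_index (F : I -> T -> \bar R) :
  (forall i, measurable_fun setT (F i)) ->
  measurable_fun setT (fun w => F (W w) w).
Proof.
move=> mF; rewrite -piece_partition; apply/measurable_fun_bigcup => // n.
rewrite /piece; case: pickle_inv => [i|]; last exact: measurable_fun_set0.
apply: (eq_measurable_fun (F i)) => [w|]; first by rewrite inE/= => ->.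
exact: measurable_funTS.
Qed.

(** On each event [W = i], the random index is frozen and [F i] is independent of
    that event. *)
Lemma expectation_random_index (F : I -> T -> R) :
  (forall i, measurable_fun setT (F i)) -> (forall i w, (0 <= F i w)%R) ->
  (forall i x, P ([set w | W w = i] `&` above true (F i) x) =
               P [set w | W w = i] * P (above true (F i) x)) ->
  \int[P]_w (F (W w) w)%:E = \int[P]_w \int[P]_v (F (W w) v)%:E.
Proof.
move=> mF F0 ind.
have mF' i : measurable_fun setT (EFin \o F i) by exact/measurable_EFinP.
have m1 := measurable_random_index mF'.
have m2 : measurable_fun setT (fun w : T => \int[P]_v (F (W w) v)%:E).
  exact: (@measurable_random_index (fun i _ => \int[P]_v (F i v)%:E)).
rewrite -piece_partition in m1.
move: m2; rewrite -[X in measurable_fun X _]piece_partition => m2.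
transitivity (\int[P]_(w in \bigcup_n piece n) (F (W w) w)%:E).
  by rewrite piece_partition.
transitivity (\int[P]_(w in \bigcup_n piece n) \int[P]_v (F (W w) v)%:E); last first.
  by rewrite piece_partition.
rewrite ge0_integral_bigcup//; last by move=> w _; rewrite lee_fin.
rewrite [RHS]ge0_integral_bigcup//; last first.
  by move=> w _; apply: integral_ge0 => v _; rewrite lee_fin.
apply: eq_eseriesr => n _; have := mpiece n; rewrite /piece.
case: pickle_inv => [i mi|]; last by rewrite !integral_set0.
transitivity (P [set w | W w = i] * \int[P]_v (F i v)%:E).
  rewrite -(@expectation_mul_indic _ _ _ _ true)//; last exact: aeW.
  rewrite integral_mkcond; apply: eq_integral => w _.
  rewrite patchE indicE; case: ifPn => [|_]; last by rewrite mul0e.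
  by rewrite inE/= => ->; rewrite mul1e.
transitivity (\int[P]_(w in [set w | W w = i]) cst (\int[P]_v (F i v)%:E) w).
  by rewrite integral_cst//; exact: muleC.
by apply: eq_integral => w; rewrite inE/= => ->.
Qed.

End countable_partition.

End random_index.

Section generated_events.
Set Implicit Arguments.
Unset Strict Implicit.
Context d (T : measurableType d) (R : realType) (P : probability T R).
Context (I : Type) (D : set I) d' (T' : measurableType d') (X : I -> T -> T').

(** Naming the system that generates [generated_sigma D X] turns this
    sigma-algebra into a measurable type, on which measurable functions can be
    combined. *)
Definition generators : set (set T) :=
  \bigcup_(i in D) preimage_set_system setT (X i) measurable.

Lemma measurable_fun_generated i : D i ->
  measurable_fun (setT : set (g_sigma_algebraType generators)) (X i).
Proof.
move=> Di _ B mB; rewrite setTI; apply: sub_sigma_algebra.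
by exists i => //; exists B => //; rewrite setTI.
Qed.

Lemma generated_preimage i B : D i -> measurable B ->
  generated_sigma D X (X i @^-1` B).
Proof.
by move=> Di mB; have := measurable_fun_generated Di measurableT mB; rewrite setTI.
Qed.

Lemma generated_above b (F : T -> R) x :
  measurable_fun (setT : set (g_sigma_algebraType generators)) F ->
  generated_sigma D X (above b F x).
Proof. by move=> mF; exact: (@measurable_above _ (g_sigma_algebraType generators)). Qed.

End generated_events.

(** * Means of integrable functions *)

Section means.
Set Implicit Arguments.
Unset Strict Implicit.
Context d (T : measurableType d) (R : realType) (P : probability T R).
Implicit Types (f g : T -> R) (a b : R).

(** Integrability and the value of the integral are kept together so that means
    can be subtracted without side conditions. *)
Definition has_mean f a :=
  P.-integrable setT (EFin \o f) /\ (\int[P]_w (f w)%:E = a%:E)%E.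

Lemma mean_measurable f a : has_mean f a -> measurable_fun setT f.
Proof. by case=> /integrableP[/measurable_EFinP]. Qed.

Lemma mean_unique f a b : has_mean f a -> has_mean f b -> a = b.
Proof. by move=> [_ fa] [_]; rewrite fa => -[]. Qed.

Lemma mean_ge0 f a : measurable_fun setT f -> {ae P, forall w, 0 <= f w} ->
  (\int[P]_w (f w)%:E = a%:E)%E -> has_mean f a.
Proof.
move=> mf f0 fa; split => //; apply/integrableP; split; first exact/measurable_EFinP.
rewrite (_ : integral _ _ _ = a%:E) ?ltry// -fa.
apply: ae_eq_integral => //; do ?exact/measurable_EFinP.
  by apply: measurableT_comp => //; exact/measurable_EFinP.
by apply: filterS f0 => w f0 _; rewrite /= ger0_norm.
Qed.

Lemma mean_ae f g a : measurable_fun setT g -> {ae P, forall w, f w = g w} ->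
  has_mean f a -> has_mean g a.
Proof.
move=> mg fg mfa; have mf := mean_measurable mfa; case: mfa => fi fa.
have fg' : ae_eq P setT (EFin \o f) (EFin \o g).
  by apply: filterS fg => w e _; rewrite /= e.
split; last by rewrite -fa; apply/esym/ae_eq_integral => //; exact/measurable_EFinP.
apply/integrableP; split; first exact/measurable_EFinP.
move/integrableP : fi => [_].
rewrite (_ : integral _ _ _ = integral P setT (fun x => `|(EFin \o g) x|)%E)//.
apply: ae_eq_integral => //.
- by apply: measurableT_comp => //; exact/measurable_EFinP.
- by apply: measurableT_comp => //; exact/measurable_EFinP.
- by apply: filterS fg' => w e _; rewrite e.
Qed.

Lemma mean_cst a : has_mean (cst a) a.
Proof.
split; last first.
  apply: (etrans (integral_cst P (@measurableT _ T) a%:E)).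
  by apply: (etrans (congr1 (fun z => a%:E * z)%E (probability_setT P))); rewrite mule1.
apply: measurable_bounded_integrable => //.
  by rewrite (le_lt_trans (probability_le1 P measurableT))// ltry.
by exists `|a|; split => // M M1 w _; exact: ltW.
Qed.

Lemma meanD f g a b : has_mean f a -> has_mean g b -> has_mean (fun w => f w + g w) (a + b).
Proof.
move=> [fi fa] [gi gb]; split; first exact: (integrableD measurableT fi gi).
by have := integralD_EFin measurableT fi gi; rewrite /= fa gb.
Qed.

Lemma meanZ k f a : has_mean f a -> has_mean (fun w => k * f w) (k * a).
Proof.
move=> [fi fa]; split; first exact: (integrableZl measurableT k fi).
by have := integralZl measurableT fi k; rewrite /= fa.
Qed.

Lemma meanB f g a b : has_mean f a -> has_mean g b -> has_mean (fun w => f w - g w) (a - b).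
Proof.
move=> fa gb; have := meanD fa (meanZ (-1) gb); rewrite mulN1r.
by under eq_fun do rewrite mulN1r.
Qed.

Lemma mean_sum (I : Type) (s : seq I) (F : I -> T -> R) (a : I -> R) :
  (forall i, has_mean (F i) (a i)) ->
  has_mean (fun w => \sum_(i <- s) F i w) (\sum_(i <- s) a i).
Proof.
move=> Fa; elim: s => [|i s IH].
  by rewrite big_nil; under eq_fun do rewrite big_nil; exact: mean_cst.
by rewrite big_cons; under eq_fun do rewrite big_cons; exact: meanD.
Qed.

Lemma mean_le f g a b : has_mean f a -> has_mean g b ->
  {ae P, forall w, f w <= g w} -> a <= b.
Proof.
move=> fa gb fg; have [ii] := meanB gb fa; have mfg := mean_measurable (meanB gb fa).
rewrite -subr_ge0 -lee_fin => <-.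
rewrite (_ : integral _ _ _ = \int[P]_w (Num.max (g w - f w) 0)%:E)%E.
  by apply: integral_ge0 => w _; rewrite lee_fin le_max lexx orbT.
apply: ae_eq_integral => //.
- exact/measurable_EFinP.
- exact/measurable_EFinP/measurable_maxr.
- by apply: filterS fg => w h _; rewrite max_l// subr_ge0.
Qed.

Lemma mean_dominated f g b : measurable_fun setT f ->
  {ae P, forall w, 0 <= f w <= g w} -> has_mean g b -> exists a, has_mean f a.
Proof.
move=> mf fg gb; have mg := mean_measurable gb.
have f0 : {ae P, forall w, 0 <= f w} by apply: filterS fg => w /andP[].
pose f' w := Num.max (f w) 0; pose g' w := Num.max (g w) 0.
have mg' : measurable_fun setT g' by exact: measurable_maxr.
have mf' : measurable_fun setT f' by exact: measurable_maxr.
have ff' : {ae P, forall w, f' w = f w} by exact: ae_ge0_max.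
have [g'i g'b] : has_mean g' b.
  apply: mean_ae gb => //; apply: filterS fg => w /andP[h1 h2].
  by rewrite /g' max_l// (le_trans h1).
have fin : (\int[P]_w (f' w)%:E < +oo)%E.
  apply: (@le_lt_trans _ _ (\int[P]_w (g' w)%:E)%E); last by rewrite g'b ltry.
  apply: ae_ge0_le_integral => //.
  - by move=> w _; rewrite lee_fin le_max lexx orbT.
  - exact/measurable_EFinP.
  - by move=> w _; rewrite lee_fin le_max lexx orbT.
  - exact/measurable_EFinP.
  - by apply: filterS2 fg ff' => w /andP[h1 h2] -> _; rewrite lee_fin /g' le_max h2.
have pos : (0 <= \int[P]_w (f' w)%:E)%E.
  by apply: integral_ge0 => w _; rewrite lee_fin le_max lexx orbT.
exists (fine (\int[P]_w (f' w)%:E)%E); apply: (@mean_ae f') => //.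
apply: mean_ge0 => //; last by rewrite fineK// ge0_fin_numE.
by apply: aeW => w; rewrite le_max lexx orbT.
Qed.

Lemma mean_ge0_le f a : has_mean f a -> {ae P, forall w, 0 <= f w} -> 0 <= a.
Proof. by move=> fa; apply: (mean_le (mean_cst 0) fa). Qed.

Lemma mean_mul_independent (e : bool) f g a c :
  has_mean f a -> {ae P, forall w, 0 <= f w} -> has_mean g c -> {ae P, forall w, 0 <= g w} ->
  (forall x y : R, 0 <= x -> 0 <= y ->
    P (above e f x `&` above e g y) = (P (above e f x) * P (above e g y))%E) ->
  has_mean (fun w => f w * g w) (a * c).
Proof.
move=> fa f0 gc g0 ind; have mf := mean_measurable fa; have mg := mean_measurable gc.
apply: mean_ge0; first exact: measurable_funM.
  by apply: filterS2 f0 g0 => w; move=> h1 h2; rewrite mulr_ge0.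
by rewrite (@expectation_mul_of_independent _ _ _ _ e)//; rewrite fa.2 gc.2 EFinM.
Qed.

Lemma le_probability_ae (A B : set T) : measurable A -> measurable B ->
  {ae P, forall w, A w -> B w} -> (P A <= P B)%E.
Proof.
move=> mA mB AB; rewrite -(setIT A) -(setIT B) -!integral_indic//.
apply: ae_ge0_le_integral => //; do ?exact/measurable_EFinP.
apply: filterS AB => w AB _; rewrite lee_fin !indicE ler_nat.
by case: (boolP (w \in A)) => //; rewrite inE => /AB/mem_set ->.
Qed.

Lemma eq_probability_ae (A B : set T) : measurable A -> measurable B ->
  {ae P, forall w, A w <-> B w} -> P A = P B.
Proof.
move=> mA mB AB; apply/eqP; rewrite eq_le; apply/andP; split;
  by apply: le_probability_ae => //; apply: filterS AB => w [].
Qed.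

Lemma mean_indic (A : set T) : measurable A -> has_mean (\1_A) (fine (P A)).
Proof.
move=> mA; apply: mean_ge0; first exact: measurable_indic.
  by apply: aeW => w; rewrite indicE.
by rewrite integral_indic// setIT fineK// fin_num_measure.
Qed.

End means.

(** * Levy processes and Poisson processes *)

Section levy_and_poisson.
Set Implicit Arguments.
Unset Strict Implicit.
Context d (T : measurableType d) (R : realType) (P : probability T R).

Section levy.
Variable L : R -> T -> R.
Hypothesis levyL : Levy_process P L.

Let mL t : 0 <= t -> measurable_fun setT (L t).
Proof. by case: levyL => mL _ _ _ _; exact: mL. Qed.

Lemma levy_increment (u v : R) (B : set R) : 0 <= u -> u <= v -> measurable B ->
  P [set w | B (L v w - L u w)] = P [set w | B (L (v - u) w)].
Proof.
case: levyL => _ _ _ st _ u0 uv mB.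
by have := st u (v - u) B u0; rewrite subr_ge0 addrC subrK; exact.
Qed.

(** The increments over [0, u] and [u, v] are independent, the first one is [L u]
    almost surely, and the second one is stationary. *)
Lemma levy_markov (u v : R) (B C : set R) : 0 <= u -> u <= v ->
  measurable B -> measurable C ->
  P ([set w | B (L u w)] `&` [set w | C (L v w - L u w)]) =
  (P [set w | B (L u w)] * P [set w | C (L (v - u)%R w)])%E.
Proof.
move=> u0 uv mB mC; have v0 := le_trans u0 uv.
rewrite -(levy_increment u0 uv mC).
have mB' (D : set R) t : measurable D -> 0 <= t -> measurable [set w | D (L t w)].
  by move=> mD t0; have := mL t0 measurableT mD; rewrite setTI.
have mI (D : set R) s t : measurable D -> 0 <= s -> 0 <= t ->
    measurable [set w | D (L t w - L s w)].
  move=> mD s0 t0; have m : measurable_fun setT (fun w => L t w - L s w).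
    by apply: measurable_funB; exact: mL.
  by have := m measurableT D mD; rewrite setTI.
case: levyL => _ L0 ind _ _.
(* Constant from the second step on: only the first two increments matter. *)
pose t n : R := match n with 0%N => 0 | 1%N => u | _ => v end.
have tS n : t n <= t n.+1 by case: n => [|[|n]].
have := ind t (lexx _) tS.
move=> /(_ [:: 0%N; 1%N] (fun i => if i == 0%N then B else C)) /=.
move=> /(_ isT); rewrite !big_cons big_nil mule1 => h.
rewrite -(_ : P [set w | B (L u w - L 0 w)] = P [set w | B (L u w)]); last first.
  apply: eq_probability_ae; [exact: mI|exact: mB'|].
  by apply: filterS L0 => w Lw0; rewrite /= Lw0 subr0.
rewrite -[RHS]h; last by move=> i; case: ifP.
apply: eq_probability_ae; first by apply: measurableI; [exact: mB'|exact: mI].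
  apply: fin_bigcap_measurable; first exact: finite_seq.
  by move=> [|[|i]] _; exact: mI.
apply: filterS L0 => w Lw0; split => /=.
  move=> [h1 h2] [|[|i]] /=; rewrite !inE//= => _.
  by rewrite Lw0 subr0.
move=> H; split; last by have := H 1%N; apply; rewrite /= inE.
by have /= := H 0%N; rewrite Lw0 subr0; apply; rewrite /= inE.
Qed.

End levy.

Lemma expectation_count (N : T -> nat) (g p : nat -> R) : measurable_fun setT N ->
  (forall n, 0 <= g n) -> (forall n, P [set w | N w = n] = (p n)%:E) ->
  (\int[P]_w (g (N w))%:E = \sum_(n <oo) (g n * p n)%:E)%E.
Proof.
move=> mN g0 Np.
have mpre n : measurable [set w | N w = n].
  by have := mN measurableT [set n] I; rewrite setTI.
have U : \bigcup_n [set w | N w = n] = setT.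
  by apply/seteqP; split => // w _; exists (N w).
transitivity (\int[P]_(w in \bigcup_n [set w | N w = n]) (g (N w))%:E)%E.
  by rewrite U.
rewrite ge0_integral_bigcup//.
- apply: eq_eseriesr => n _.
  transitivity (\int[P]_(w in [set w | N w = n]) cst (g n)%:E w)%E.
    by apply: eq_integral => w; rewrite inE/= => ->.
  by rewrite integral_cst//; rewrite EFinM -Np.
- rewrite U; apply/measurable_EFinP.
  by apply: (measurableT_comp (f := g)).
- by move=> w _; rewrite lee_fin.
- by move=> m n _ _ [w [/= <- <-]].
Qed.

Lemma nneseries_shift (f : nat -> \bar R) : (forall n, 0 <= f n)%E -> f 0%N = 0%E ->
  (\sum_(n <oo) f n = \sum_(n <oo) f n.+1)%E.
Proof.
move=> f0 fz; rewrite nneseries_recl//.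
rewrite fz add0e -nneseries_addn//.
by apply: eq_eseriesr => n _; rewrite addn1.
Qed.

Section poisson.
Variables (N : T -> nat) (r : R).
Hypotheses (mN : measurable_fun setT N) (r0 : 0 < r).
Hypothesis Np : forall n, P [set w | N w = n] = (poisson_pmf r n)%:E.

Let pmf_rec n : n.+1%:R * poisson_pmf r n.+1 = r * poisson_pmf r n.
Proof.
rewrite /poisson_pmf r0 factS natrM exprS; field.
by rewrite nat1r !pnatr_eq0 -lt0n fact_gt0.
Qed.

(** The weights of the Poisson law satisfy [(n + 1) p (n + 1) = r p n]. *)
Let poisson_shift (h : nat -> R) : (forall n, 0 <= h n) ->
  (\int[P]_w ((N w)%:R * h (N w))%:E = r%:E * \int[P]_w (h (N w).+1)%:E)%E.
Proof.
move=> h0.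
have pos n : 0 <= poisson_pmf r n by exact: poisson_pmf_ge0.
rewrite (expectation_count (g := fun n => n%:R * h n) mN _ Np); last first.
  by move=> n; rewrite mulr_ge0.
rewrite (expectation_count (g := fun n => h n.+1) mN _ Np)//.
rewrite nneseries_shift; last 2 first.
- by move=> n; rewrite lee_fin !mulr_ge0.
- by rewrite !mul0r.
rewrite -nneseriesZl; last by move=> n _; rewrite lee_fin mulr_ge0.
apply: eq_eseriesr => n _; rewrite -EFinM; congr EFin.
by rewrite mulrAC pmf_rec; ring.
Qed.

Lemma poisson_mean : has_mean P (fun w => (N w)%:R) r.
Proof.
have mNr : measurable_fun setT (fun w => (N w)%:R : R).
  exact: (measurableT_comp (f := fun n : nat => n%:R : R)).
apply: mean_ge0 => //; first exact: aeW.
have := @poisson_shift (fun=> 1) (fun=> ler01).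
under eq_integral do rewrite mulr1.
by move=> ->; rewrite (mean_cst P 1).2 mule1.
Qed.

Lemma poisson_mean2 : has_mean P (fun w => (N w)%:R ^+ 2) (r + r ^+ 2).
Proof.
have mNr : measurable_fun setT (fun w => (N w)%:R : R).
  exact: (measurableT_comp (f := fun n : nat => n%:R : R)).
apply: mean_ge0; first exact: measurable_funX.
  by apply: aeW => w; rewrite sqr_ge0.
under eq_integral do rewrite expr2.
rewrite (@poisson_shift (fun n => n%:R))// (_ : integral _ _ _ = (r + 1)%:E).
  by rewrite -EFinM; congr EFin; ring.
rewrite -(meanD poisson_mean (mean_cst P 1)).2.
by apply: eq_integral => w _; rewrite natr1.
Qed.

End poisson.

End levy_and_poisson.

Section poisson_process.
Set Implicit Arguments.
Unset Strict Implicit.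
Context d (T : measurableType d) (R : realType) (P : probability T R).
Variables (rate : R) (N : R -> T -> nat).
Hypotheses (rate0 : 0 < rate) (NP : Poisson_process P rate N).

Let mN u : 0 <= u -> measurable_fun setT (N u).
Proof. by case: NP => mN _ _ u0; exact: mN. Qed.

Let mNR u : 0 <= u -> measurable_fun setT (fun w => (N u w)%:R : R).
Proof.
move=> u0; apply: (measurableT_comp (f := fun n : nat => n%:R : R)) => //.
exact: mN.
Qed.

(** An increment has the law of a value of [N], which cannot be negative. *)
Lemma poisson_process_nondecreasing u v : 0 <= u -> u <= v ->
  {ae P, forall w, (N u w <= N v w)%N}.
Proof.
move=> u0 uv; have [_ levyN _] := NP.
have mB : measurable [set x : R | x < 0] by rewrite -set_itvNyo; exact: measurable_itv.
have := levy_increment levyN u0 uv mB.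
rewrite (_ : [set w | _ ((N (v - u) w)%:R)] = set0) ?measure0; last first.
  by apply/seteqP; split => w //=; rewrite ltrn0.
move=> h; exists [set w | ((N v w)%:R - (N u w)%:R : R) < 0]; split => //.
  have m : measurable_fun setT (fun w => (N v w)%:R - (N u w)%:R : R).
    by apply: measurable_funB; apply: mNR => //; exact: le_trans uv.
  by have := m measurableT _ mB; rewrite setTI.
by move=> w /=; rewrite subr_lt0 ltr_nat => /negP; rewrite -ltnNge.
Qed.

Lemma poisson_process_mean u : 0 <= u -> has_mean P (fun w => (N u w)%:R) (rate * u).
Proof.
move=> u0; have [_ [_ N0 _ _ _] pmf] := NP.
have [u0'|u0'|<-] := ltgtP 0 u; last 2 first.
- by have := lt_le_trans u0' u0; rewrite ltxx.
- rewrite mulr0; apply: (@mean_ae _ _ _ _ (cst 0)); first exact: mNR.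
  + by apply: filterS N0 => w ->.
  + exact: mean_cst.
by apply: poisson_mean; [exact: mN|exact: mulr_gt0|move=> n; exact: pmf].
Qed.

Lemma poisson_process_mean2 u : 0 <= u ->
  has_mean P (fun w => (N u w)%:R ^+ 2) (rate * u + (rate * u) ^+ 2).
Proof.
move=> u0; have [_ [_ N0 _ _ _] pmf] := NP.
have [u0'|u0'|<-] := ltgtP 0 u; last 2 first.
- by have := lt_le_trans u0' u0; rewrite ltxx.
- rewrite mulr0 expr0n/= addr0; apply: (@mean_ae _ _ _ _ (cst 0)).
  + exact/measurable_funX/mNR.
  + by apply: filterS N0 => w ->; rewrite expr0n.
  + exact: mean_cst.
by apply: poisson_mean2; [exact: mN|exact: mulr_gt0|move=> n; exact: pmf].
Qed.

(** [N u N v = N u ^ 2 + N u (N v - N u)], where the last two factors are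
    independent. *)
Lemma poisson_process_mean_mul u v : 0 <= u -> u <= v ->
  has_mean P (fun w => (N u w)%:R * (N v w)%:R) (rate * u + rate ^+ 2 * u * v).
Proof.
move=> u0 uv; have v0 := le_trans u0 uv; have [_ levyN _] := NP.
have Nu := poisson_process_mean u0; have Nv := poisson_process_mean v0.
have mono := poisson_process_nondecreasing u0 uv.
have mset b (x : R) : measurable [set y : R | x < y ?<= if b].
  case: b => /=; first by rewrite -set_itvcy; exact: measurable_itv.
  by rewrite -set_itvoy; exact: measurable_itv.
have cross : has_mean P (fun w => (N u w)%:R * ((N v w)%:R - (N u w)%:R))
    (rate * u * (rate * v - rate * u)).
  apply: (@mean_mul_independent _ _ _ _ true).
  - exact: Nu.
  - exact: aeW.
  - exact: meanB.
  - by apply: filterS mono => w; rewrite subr_ge0 ler_nat.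
  move=> x y _ _; have := levy_markov levyN u0 uv (mset true x) (mset true y).
  by rewrite -(levy_increment levyN u0 uv (mset true y)).
rewrite (_ : rate * u + rate ^+ 2 * u * v = rate * u + (rate * u) ^+ 2 +
  rate * u * (rate * v - rate * u)); last by ring.
have := meanD (poisson_process_mean2 u0) cross.
apply: mean_ae; first by apply: measurable_funM; exact: mNR.
by apply: aeW => w; rewrite expr2 mulrBr addrC subrK.
Qed.

End poisson_process.

(** * Sums of jumps *)

Section jumps.
Set Implicit Arguments.
Unset Strict Implicit.
Context d (T : measurableType d) (R : realType) (P : probability T R).
Context (k : nat) (lam : 'I_k -> R) (X : nat -> T -> nat).
Hypotheses (k0 : (1 <= k)%N) (lam0 : forall j, 0 < lam j) (XJ : iid_jumps P lam X).
Local Notation rate := (total_rate lam).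

Lemma total_rate_gt0 : 0 < rate.
Proof.
rewrite /total_rate; case: k k0 lam lam0 => // k' _ l l0.
by rewrite big_ord_recl ltr_pwDl// sumr_ge0// => i _; exact: ltW.
Qed.

Definition jump_moment (n : nat) : R := \sum_(j < k) j.+1%:R ^+ n * (lam j / rate).

Lemma jump_moment_gt0 n : 0 < jump_moment n.
Proof.
have r0 := total_rate_gt0; rewrite /jump_moment.
move: r0; set r := total_rate _; move: r.
case: k k0 lam lam0 => // k' _ l l0 r r0.
rewrite big_ord_recl ltr_pwDl//; first by rewrite mulr_gt0 ?divr_gt0// exprn_gt0.
by rewrite sumr_ge0// => i _; rewrite mulr_ge0 ?divr_ge0 ?exprn_ge0// ltW.
Qed.

Let mX i : measurable_fun setT (X i). Proof. by case: XJ. Qed.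

Let mpre i (B : set nat) : measurable (X i @^-1` B).
Proof. by have := @mX i measurableT B I; rewrite setTI. Qed.

Let mXR (g : nat -> R) i : measurable_fun setT (fun w => g (X i w)).
Proof. exact: (measurableT_comp (f := g)). Qed.

Lemma indic_jump_range i w :
  \sum_(j < k) (\1_(X i @^-1` [set j.+1]) w : R) =
  \1_(X i @^-1` [set n | exists j : 'I_k, n = j.+1]) w.
Proof.
rewrite [RHS]indicE; case: (boolP (w \in _)) => [|nw].
  rewrite inE => -[j /= Xj]; rewrite (bigD1 j)//= indicE mem_set//= big1 ?addr0//.
  move=> l lj; rewrite indicE memNset//= Xj => -[] /ord_inj jl.
  by rewrite jl eqxx in lj.
rewrite big1// => j _; rewrite indicE memNset//= => Xj.
by move/negP: nw; apply; rewrite inE /=; exists j.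
Qed.

(** The prescribed probabilities of the values [1, ..., k] add up to 1. *)
Lemma jump_range i : {ae P, forall w, exists j : 'I_k, X i w = j.+1}.
Proof.
have [_ _ pX] := XJ; set A := X i @^-1` [set n | exists j : 'I_k, n = j.+1].
have mA : measurable A by exact: mpre.
have : has_mean P (\1_A : T -> R) 1.
  rewrite (_ : 1 = \sum_(j < k) fine (P (X i @^-1` [set j.+1]))); last first.
    under eq_bigr do rewrite [P _]pX /=.
    by rewrite -mulr_suml divff// gt_eqF// total_rate_gt0.
  rewrite (_ : \1_A = fun w => \sum_(j < k) \1_(X i @^-1` [set j.+1]) w); last first.
    by apply/funext => w; rewrite indic_jump_range.
  by apply: mean_sum => j; apply: mean_indic; exact: mpre.
move/(mean_unique (mean_indic P mA)) => PA.
exists (~` A); split => //; first exact: measurableC.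
by rewrite probability_setC// -(fineK (fin_num_measure P _ mA)) PA subee.
Qed.

Lemma jump_mean (g : nat -> R) i :
  has_mean P (fun w => g (X i w)) (\sum_(j < k) g j.+1 * (lam j / rate)).
Proof.
have [_ _ pX] := XJ.
apply: (@mean_ae _ _ _ _ (fun w => \sum_(j < k) g j.+1 * \1_(X i @^-1` [set j.+1]) w)).
- exact: mXR.
- apply: filterS (jump_range i) => w [j Xj].
  rewrite (bigD1 j)//= indicE mem_set//= mulr1 big1 ?addr0 ?Xj//.
  move=> l lj; rewrite indicE memNset ?mulr0//= Xj => -[] /ord_inj jl.
  by rewrite jl eqxx in lj.
apply: mean_sum => j; apply: meanZ.
rewrite (_ : lam j / rate = fine (P (X i @^-1` [set j.+1]))); last by rewrite [P _]pX.
by apply: mean_indic; exact: mpre.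
Qed.

Lemma jump_mean_mul i j :
  has_mean P (fun w => (X i w)%:R * (X j w)%:R)
    (if i == j then jump_moment 2 else jump_moment 1 ^+ 2).
Proof.
case: eqVneq => [<-|ij].
  rewrite (_ : (fun _ => _) = (fun w => (X i w)%:R ^+ 2)) //.
  exact: (jump_mean (fun n => n%:R ^+ 2)).
have m1 l : has_mean P (fun w => (X l w)%:R) (jump_moment 1).
  have := jump_mean (fun n => n%:R) l.
  by rewrite /jump_moment; under [in X in _ -> X]eq_bigr do rewrite expr1.
rewrite expr2; apply: (@mean_mul_independent _ _ _ _ true);
  [exact: m1|exact: aeW|exact: m1|exact: aeW|].
move=> x y _ _; have [_ ind _] := XJ.
pose B (z : R) := [set n : nat | z <= n%:R].
have := ind [:: i; j] (fun l => if l == i then B x else B y).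
rewrite /= inE ij => /(_ isT (fun _ => I)).
rewrite !big_cons big_nil mule1 eqxx eq_sym (negbTE ij) => <-.
congr (P _); apply/seteqP; split => w.
  by move=> [h1 h2] l /=; rewrite !inE => /orP[] /eqP ->;
    rewrite ?eqxx// eq_sym (negbTE ij).
move=> h; split.
  by have /= := h i; rewrite !inE eqxx; apply.
by have /= := h j; rewrite !inE eqxx orbT eq_sym (negbTE ij); apply.
Qed.

Definition jump_sum (n : nat) (w : T) : R := (\sum_(i < n) X i w)%N%:R.

Lemma jump_sum_mean n : has_mean P (jump_sum n) (n%:R * jump_moment 1).
Proof.
have m1 l : has_mean P (fun w => (X l w)%:R) (jump_moment 1).
  have := jump_mean (fun n => n%:R) l.
  by rewrite /jump_moment; under [in X in _ -> X]eq_bigr do rewrite expr1.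
rewrite (_ : n%:R * _ = \sum_(i < n) jump_moment 1); last first.
  by rewrite sumr_const card_ord mulr_natl.
rewrite (_ : jump_sum n = fun w => \sum_(i < n) (X i w)%:R).
  by apply: mean_sum.
by apply/funext => w; rewrite /jump_sum natr_sum.
Qed.

(** Among the products [X i X j], the [m] diagonal ones have mean [jump_moment 2],
    and the factors of the others are independent. *)
Lemma jump_sum_mean_mul m n : (m <= n)%N ->
  has_mean P (fun w => jump_sum m w * jump_sum n w)
    (m%:R * jump_moment 2 + (m%:R * n%:R - m%:R) * jump_moment 1 ^+ 2).
Proof.
move=> mn.
rewrite (_ : (fun _ => _) = (fun w =>
    \sum_(i < m) \sum_(j < n) (X i w)%:R * (X j w)%:R)); last first.
  apply/funext => w; rewrite /jump_sum !natr_sum mulr_suml.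
  by apply: eq_bigr => i _; rewrite mulr_sumr.
rewrite (_ : _ + _ = \sum_(i < m) \sum_(j < n)
    (if val i == val j then jump_moment 2 else jump_moment 1 ^+ 2)); last first.
  rewrite (eq_bigr (fun=> jump_moment 2 + (n%:R - 1) * jump_moment 1 ^+ 2)).
    by rewrite sumr_const card_ord -mulr_natl; ring.
  move=> i _; pose i' := widen_ord mn i.
  rewrite (bigD1 i')//= eqxx; congr (_ + _).
  rewrite (eq_bigr (fun=> jump_moment 1 ^+ 2)); last first.
    move=> j ji; case: eqP => // ij; move/eqP: ji => []; exact: val_inj.
  rewrite sumr_const cardC1 card_ord -[LHS]mulr_natl; congr (_ * _).
  by rewrite -subn1 natrB// (leq_trans _ (ltn_ord i')).
by apply: mean_sum => i; apply: mean_sum => j; exact: jump_mean_mul.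
Qed.

End jumps.

(** * Moments of the generalized counting process *)

Section compound_moments.
Set Implicit Arguments.
Unset Strict Implicit.
Context d (T : measurableType d) (R : realType) (P : probability T R).
Context (k : nat) (lam : 'I_k -> R) (N : R -> T -> nat) (X : nat -> T -> nat).
Hypotheses (k0 : (1 <= k)%N) (lam0 : forall j, 0 < lam j).
Local Notation rate := (total_rate lam).
Hypotheses (NP : Poisson_process P rate N) (XJ : iid_jumps P lam X).
Hypothesis NX : independent_families P (@times R) N setT X.
Local Notation M := (compound (R := R) N X).
Local Notation mom := (jump_moment lam).

Let mN u : 0 <= u -> measurable_fun setT (N u).
Proof. by case: NP => mN _ _ u0; exact: mN. Qed.

Let mX i : measurable_fun setT (X i). Proof. by case: XJ. Qed.

Let mS d' (S : measurableType d') (Z : nat -> S -> nat) n :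
  (forall i, measurable_fun setT (Z i)) ->
  measurable_fun setT (fun w => (\sum_(i < n) Z i w)%N%:R : R).
Proof.
move=> mZ; under eq_fun do rewrite natr_sum.
apply: measurable_sum => i.
by apply: (measurableT_comp (f := fun n : nat => n%:R : R)).
Qed.

Let mNset u m : 0 <= u -> measurable [set w | N u w = m].
Proof. by move=> u0; have := mN u0 measurableT (Y := [set m]) I; rewrite setTI. Qed.

Lemma measurable_compound u : 0 <= u -> measurable_fun setT (M u).
Proof.
move=> u0; apply/measurable_EFinP.
apply: (@measurable_random_index _ _ _ _ (N u) (fun m => mNset m u0)
  (fun n w => ((\sum_(i < n) X i w)%N%:R : R)%:E)).
by move=> n; apply/measurable_EFinP; exact: mS.
Qed.

Let Ngen u m : 0 <= u -> generated_sigma (@times R) N [set w | N u w = m].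
Proof. by move=> u0; exact: (@generated_preimage _ _ _ _ _ _ N u [set m] u0 I). Qed.

Let mSgen n : measurable_fun (setT : set (g_sigma_algebraType (generators setT X)))
  (jump_sum R X n).
Proof. by apply: mS => i; exact: measurable_fun_generated. Qed.

Lemma compound_mean u : 0 <= u -> has_mean P (M u) (rate * mom 1 * u).
Proof.
move=> u0; apply: mean_ge0; first exact: measurable_compound.
  exact: aeW.
have := @expectation_random_index _ _ _ P _ (N u) (fun m => mNset m u0) (jump_sum R X).
move=> /(_ (fun n => mS n mX)) ->; last 2 first.
- by [].
- move=> m x; apply: NX; first exact: Ngen.
  exact: generated_above.
under eq_integral do rewrite (jump_sum_mean k0 lam0 XJ _).2 mulrC.
rewrite (meanZ (mom 1) (poisson_process_mean (total_rate_gt0 k0 lam0) NP u0)).2.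
by congr EFin; ring.
Qed.

(** Given [N u] and [N v], the mean is that of [jump_sum_mean_mul], a combination
    of [N u] and [N u N v]. *)
Lemma compound_mean_mul u v : 0 <= u -> u <= v ->
  has_mean P (fun w => M u w * M v w)
    (rate * mom 2 * u + (rate * mom 1) ^+ 2 * u * v).
Proof.
move=> u0 uv; have v0 := le_trans u0 uv.
have r0 := total_rate_gt0 k0 lam0.
apply: mean_ge0; first by apply: measurable_funM; exact: measurable_compound.
  by apply: aeW => w; rewrite mulr_ge0.
have mW (p : nat * nat) : measurable [set w | (N u w, N v w) = p].
  rewrite (_ : [set w | _] = [set w | N u w = p.1] `&` [set w | N v w = p.2]).
    by apply: measurableI; exact: mNset.
  by apply/seteqP; split => w /=; case: p => a b //= [-> ->].
have := @expectation_random_index _ _ _ P _ (fun w => (N u w, N v w)) mW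
  (fun p w => jump_sum R X p.1 w * jump_sum R X p.2 w).
move=> /(_ _ _ _) ->; first last.
- move=> p x; apply: NX; last by apply: generated_above; exact: measurable_funM.
  rewrite (_ : [set w | _] = [set w | N u w = p.1] `&` [set w | N v w = p.2]).
    exact: (@measurableI _ (g_sigma_algebraType (generators (@times R) N)) _ _
      (Ngen _ u0) (Ngen _ v0)).
  by apply/seteqP; split => w /=; case: p => a b //= [-> ->].
- by move=> p w; rewrite mulr_ge0.
- by move=> p; apply: measurable_funM; exact: mS.
have := meanD (meanZ (mom 2) (poisson_process_mean r0 NP u0))
  (meanZ (mom 1 ^+ 2) (meanB (poisson_process_mean_mul r0 NP u0 uv)
    (poisson_process_mean r0 NP u0))).
rewrite (_ : mom 2 * _ + _ = rate * mom 2 * u + (rate * mom 1) ^+ 2 * u * v);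
  last by ring.
case=> /integrableP[ig _] <-; apply: ae_eq_integral => //.
  exact: (@measurable_random_index _ _ _ _ _ mW
    (fun p _ => (\int[P]_v (jump_sum R X p.1 v * jump_sum R X p.2 v)%:E)%E)).
apply: filterS (poisson_process_nondecreasing NP u0 uv) => w Nuv _ /=.
rewrite (jump_sum_mean_mul k0 lam0 XJ Nuv).2; congr EFin.
by rewrite mulrC [_ ^+ 2 * _]mulrC.
Qed.

End compound_moments.

(** * The stable subordinator and its first passages *)

Section inverse_subordinator.
Set Implicit Arguments.
Unset Strict Implicit.
Context d (T : measurableType d) (R : realType) (P : probability T R).
Variables (alpha : R) (D Y : R -> T -> R).
Hypothesis (DP : stable_subordinator P alpha D).
Hypothesis mY : stochastic_process Y.
Hypothesis YD : {ae P, forall w, forall t : R, 0 <= t ->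
  Y t w = inf [set x | 0 < x /\ t < D x w]}.

Lemma mean_eq0_ae (f : T -> R) : has_mean P f 0 -> {ae P, forall w, 0 <= f w} ->
  {ae P, forall w, f w = 0}.
Proof.
move=> f0 fp; have mf := mean_measurable f0.
have mf' : measurable_fun setT (EFin \o f) by exact/measurable_EFinP.
have [h _] := ae_eq_integral_abs P measurableT mf'.
have : ae_eq P setT (EFin \o f) (cst 0%E).
  apply: h; apply: (etrans _ f0.2); apply: ae_eq_integral => //.
    exact: measurableT_comp.
  by apply: filterS fp => w fw _; rewrite /= ger0_norm.
by apply: filterS => w /(_ I) [].
Qed.

Lemma measurable_subordinator x : 0 <= x -> measurable_fun setT (D x).
Proof. by move=> x0; case: DP => -[mD _ _ _ _] _ _; exact: mD. Qed.

Lemma subordinator_ge0 : {ae P, forall w, forall x, 0 <= x -> 0 <= D x w}.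
Proof.
case: DP => -[_ D0 _ _ _] Dm _; apply: filterS2 D0 Dm => w D0 Dm x x0.
by rewrite -D0 Dm.
Qed.

Definition below (x t : R) : set T := [set w | D x w <= t].

Lemma measurable_below x t : 0 <= x -> measurable (below x t).
Proof.
move=> x0; have := @measurable_subordinator x x0 measurableT _ (measurable_itv `]-oo, t]).
by rewrite setTI set_itvE.
Qed.

Lemma laplace_subordinator s x : 0 < s -> 0 <= x ->
  (\int[P]_w (expR (- s * D x w))%R%:E = (expR (- x * s `^ alpha))%R%:E)%E.
Proof. case: DP => _ _ lap s0 x0; have := lap s x s0 x0.
by rewrite expectation.unlock. Qed.

Lemma laplace_subordinator_mean s x : 0 < s -> 0 <= x ->
  has_mean P (fun w => expR (- s * D x w)) (expR (- x * s `^ alpha)).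
Proof.
move=> s0 x0; apply: mean_ge0; last exact: laplace_subordinator.
  apply: measurableT_comp => //; apply: measurable_funM => //.
  exact: measurable_subordinator.
by apply: aeW => w; exact: expR_ge0.
Qed.

(** Chernoff's bound, from the Laplace transform at 1. *)
Lemma subordinator_tail x t : 0 <= x -> fine (P (below x t)) <= expR (t - x).
Proof.
move=> x0; have m := laplace_subordinator_mean ltr01 x0.
have := meanZ (expR t) m; rewrite powR1 mulr1 -expRD => m'.
apply: (mean_le (mean_indic P (measurable_below t x0)) m').
apply: aeW => w; rewrite indicE; case: (boolP (w \in _)) => [|_].
  rewrite inE /below/= => Dt; rewrite -expRD.
  have -> : t + -1 * D x w = t - D x w by ring.
  by rewrite -expR0 ler_expR subr_ge0.
by rewrite mulr_ge0 ?expR_ge0.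
Qed.

(** The subordinator is still below [t] at time [n + 1] with probability at most
    [exp (t - n - 1)]. *)
Lemma subordinator_unbounded t :
  {ae P, forall w, exists2 x, 0 < x & t < D x w}.
Proof.
pose A := \bigcap_n below n.+1%:R t.
have mA : measurable A by apply: bigcap_measurable => // n _; exact: measurable_below.
exists A; split => //; last first.
  move=> w /= h n _; rewrite /below/= leNgt; apply/negP => tD.
  by apply: h; exists n.+1%:R.
apply/eqP; rewrite eq_le measure_ge0 andbT; apply/lee_addgt0Pr => e e0.
rewrite add0e; have [n ne] : exists n : nat, expR (t - n.+1%:R) <= e.
  exists (Num.truncn (t - ln e)).
  rewrite -[leRHS]lnK ?posrE// ler_expR lerBlDr -lerBlDl ltW//.
  exact: truncnS_gt.
apply: (@le_trans _ _ (P (below n.+1%:R t))).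
  apply: le_measure; rewrite ?inE//; first exact: measurable_below.
  by move=> w; apply.
rewrite -(fineK (fin_num_measure P _ (measurable_below _ _)))// lee_fin.
exact: le_trans (subordinator_tail _ _) ne.
Qed.

(** The events [x < Y t] and [D x <= t] agree up to the case [x = Y t]; the
    infimum that defines [Y] enters the sequel in this form. *)
Lemma inverse_passage t : 0 <= t -> {ae P, forall w, 0 <= Y t w /\
  forall x, 0 <= x -> (x < Y t w -> D x w <= t) /\ (D x w <= t -> x <= Y t w)}.
Proof.
move=> t0; case: DP => -[_ D0 _ _ _] Dm _.
apply: filterS2 (filterI D0 Dm) (filterI (subordinator_unbounded t) YD).
move=> w [D0w Dmw] [[z z0 tz] Yw]; rewrite Yw//.
set A := [set x | _].
have A0 : A !=set0 by exists z.
have lbA : lbound A 0 by move=> x [/ltW].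
have hA : has_inf A by split => //; exists 0.
split; first exact: lb_le_inf.
move=> x x0; split => [xA|Dx].
  rewrite leNgt; apply/negP => tD; move: xA; rewrite ltNge => /negP; apply.
  apply: ge_inf; first by exists 0.
  split => //; rewrite lt_neqAle x0 andbT; apply/negP => /eqP x0'.
  by move: tD; rewrite -x0' D0w ltNge t0.
apply: lb_le_inf => // y [y0 tD]; rewrite leNgt; apply/negP => yx.
by move: tD; rewrite ltNge (le_trans (Dmw _ _ (ltW y0) (ltW yx))).
Qed.

Lemma inverse_ge0 t : 0 <= t -> {ae P, forall w, 0 <= Y t w}.
Proof. by move=> t0; apply: filterS (inverse_passage t0) => w []. Qed.

Lemma inverse_nondecreasing s t : 0 <= s -> s <= t ->
  {ae P, forall w, Y s w <= Y t w}.
Proof.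
move=> s0 st; have t0 := le_trans s0 st.
apply: filterS2 (inverse_passage s0) (inverse_passage t0) => w [Ys hs] [Yt ht].
rewrite leNgt; apply/negP => ts.
pose x := (Y t w + Y s w) / 2.
have x0 : 0 <= x by rewrite divr_ge0// addr_ge0.
have xs : x < Y s w by rewrite /x; lra.
have tx : Y t w < x by rewrite /x; lra.
have := (ht x x0).2 (le_trans ((hs x x0).1 xs) st).
by rewrite leNgt tx.
Qed.

Let mYt t : 0 <= t -> measurable_fun setT (Y t). Proof. exact: mY. Qed.

Lemma above_below s t x y : 0 <= s -> 0 <= t -> 0 <= x -> 0 <= y ->
  (P (above false (Y s) x `&` above false (Y t) y) <= P (below x s `&` below y t))%E.
Proof.
move=> s0 t0 x0 y0; apply: le_probability_ae.
- by apply: measurableI; apply: measurable_above; exact: mY.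
- by apply: measurableI; exact: measurable_below.
apply: filterS2 (inverse_passage s0) (inverse_passage t0) => w [_ hs] [_ ht] [h1 h2].
by split; [exact: (hs x x0).1 h1|exact: (ht y y0).1 h2].
Qed.

Lemma below_above s t x y : 0 <= s -> 0 <= t -> 0 <= x -> 0 <= y ->
  (P (below x s `&` below y t) <= P (above true (Y s) x `&` above true (Y t) y))%E.
Proof.
move=> s0 t0 x0 y0; apply: le_probability_ae.
- by apply: measurableI; exact: measurable_below.
- by apply: measurableI; apply: measurable_above; exact: mY.
apply: filterS2 (inverse_passage s0) (inverse_passage t0) => w [_ hs] [_ ht] [h1 h2].
by split; [exact: (hs x x0).2 h1|exact: (ht y y0).2 h2].
Qed.

Lemma above_below1 t x : 0 <= t -> 0 <= x ->
  (P (above false (Y t) x) <= P (below x t))%E.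
Proof. by move=> t0 x0; have := above_below t0 t0 x0 x0; rewrite !setIid. Qed.

Lemma below_above1 t x : 0 <= t -> 0 <= x ->
  (P (below x t) <= P (above true (Y t) x))%E.
Proof. by move=> t0 x0; have := below_above t0 t0 x0 x0; rewrite !setIid. Qed.

(** [D x / t] and [D (x / t ^ alpha)] have the same Laplace transform. *)
Lemma below_scaling t x : 0 < t -> 0 <= x ->
  P (below x t) = P (below (x / t `^ alpha) 1).
Proof.
move=> t0 x0; have ta : 0 < t `^ alpha by exact: powR_gt0.
have x'0 : 0 <= x / t `^ alpha by rewrite divr_ge0// ltW.
pose E w := D x w * t^-1.
have mE : measurable_fun setT E.
  by apply: measurable_funM => //; exact: measurable_subordinator.
have E0 : {ae P, forall w, 0 <= E w}.
  apply: filterS subordinator_ge0 => w h.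
  by rewrite mulr_ge0 ?h// invr_ge0 ltW.
have D0 : {ae P, forall w, 0 <= D (x / t `^ alpha) w}.
  by apply: filterS subordinator_ge0 => w; apply.
have lap s : 0 < s -> (\int[P]_w (expR (- s * E w))%R%:E =
    \int[P]_w (expR (- s * D (x / t `^ alpha) w))%R%:E)%E.
  move=> s0; rewrite (laplace_subordinator s0 x'0) /E.
  rewrite (_ : expR _ = expR (- x * (s / t) `^ alpha)).
    apply: (etrans _ (laplace_subordinator (divr_gt0 s0 t0) x0)).
    by apply: eq_integral => w _; congr (expR _)%:E; rewrite mulNr mulNr; congr (- _); ring.
  congr expR; rewrite powRM ?invr_ge0 ?ltW//.
  rewrite -(powR_inv1 (ltW t0)) -powRrM mulN1r powRN.
  by rewrite !mulNr -!mulrA; congr (- (_ * _)); rewrite mulrC.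
have := laplace_uniqueness mE E0 (measurable_subordinator x'0) D0 lap ler01.
have aC (F : T -> R) z : above false F z = ~` [set w | F w <= z].
  by apply/seteqP; split => w; rewrite /above/= ltNge => /negP.
rewrite (_ : above false E 1 = ~` below x t); last first.
  by apply/seteqP; split => w; rewrite /above /E /below/= ltNge ler_pdivrMr// mul1r => /negP.
rewrite aC -/(below _ 1) => eqC.
have mb z u : 0 <= z -> measurable (~` below z u).
  by move=> z0; apply: measurableC; exact: measurable_below.
rewrite -(setCK (below x t)) -(setCK (below (x / t `^ alpha) 1)).
by rewrite (probability_setC P (mb _ _ x0)) (probability_setC P (mb _ _ x'0)) eqC.
Qed.

End inverse_subordinator.

(** * Moments of the inverse stable subordinator *)

Section inverse_moments.
Set Implicit Arguments.
Unset Strict Implicit.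
Context d (T : measurableType d) (R : realType) (P : probability T R).
Variables (alpha : R) (D Y : R -> T -> R).
Hypotheses (alpha01 : 0 < alpha < 1) (DP : stable_subordinator P alpha D).
Hypothesis mY : stochastic_process Y.
Hypothesis YD : {ae P, forall w, forall t : R, 0 <= t ->
  Y t w = inf [set x | 0 < x /\ t < D x w]}.
Local Notation mu := (@lebesgue_measure R).

Let mYt t : 0 <= t -> measurable_fun setT (Y t). Proof. exact: mY. Qed.
Let Y0 t : 0 <= t -> {ae P, forall w, 0 <= Y t w}.
Proof. exact: (inverse_ge0 DP YD). Qed.

Lemma integral_expR_half :
  (\int[mu]_(x in `[0%R, +oo[) (expR (- x / 2))%R%:E = 2%:E)%E.
Proof.
have h0 : (0 : R) < 2^-1 by rewrite invr_gt0.
have h := integral_exponential_pdf h0.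
have := congr1 (fun z => 2%:E * z)%E h; rewrite mule1 => <-.
have pos x : (0 <= (exponential_pdf 2^-1 x : R)%:E)%E.
  by rewrite lee_fin; apply: exponential_pdf_ge0; exact: ltW.
have m : measurable_fun setT (fun x : R => (exponential_pdf 2^-1 x : R)%:E).
  by apply/measurable_EFinP; exact: measurable_exponential_pdf.
rewrite -ge0_integralZl//.
rewrite [LHS]integral_mkcond; apply: eq_integral => x _.
rewrite /exponential_pdf !patchE; case: ifP => _; last by rewrite mule0.
by rewrite -EFinM mulrA divff// mul1r; congr (expR _)%:E; ring.
Qed.

(** The probability that [Y t] exceeds both [x] and [y] is at most
    [exp (t - max x y)], hence at most [exp t exp (- x / 2) exp (- y / 2)], which is
    integrable over the quadrant. *)
Lemma inverse_square_finite t : 0 <= t ->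
  (\int[P]_w (Y t w * Y t w)%:E < +oo)%E.
Proof.
move=> t0.
rewrite (layer_cake_mul false (mYt t0) (Y0 t0) (mYt t0) (Y0 t0)).
have mab x : measurable (above false (Y t) x) by apply: measurable_above; exact: mYt.
have mexp : measurable_fun setT (fun y : R => (expR (- y / 2))%:E).
  apply/measurable_EFinP; apply: measurableT_comp => //.
  by apply: measurable_funM => //; exact: measurable_funN.
have key x y : 0 <= x -> 0 <= y ->
   (P (above false (Y t) x `&` above false (Y t) y) <=
    (expR t * expR (- x / 2))%:E * (expR (- y / 2))%:E)%E.
  wlog: x y / x <= y.
    move=> H x0 y0; have [xy|/ltW yx] := leP x y; first exact: H.
    by rewrite setIC (le_trans (H _ _ yx y0 x0))// -!EFinM lee_fin mulrAC.
  move=> xy x0 y0; apply: (@le_trans _ _ (P (above false (Y t) y))).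
    by apply: le_measure; rewrite ?inE//; exact: measurableI.
  apply: (le_trans (above_below1 DP mY YD t0 y0)).
  have mb := measurable_below DP t y0.
  rewrite -(fineK (fin_num_measure P _ mb)) -EFinM lee_fin.
  apply: (le_trans (subordinator_tail DP t y0)).
  by rewrite -!expRD ler_expR; lra.
apply: (@le_lt_trans _ _
  (\int[mu]_(x in `[0%R, +oo[) ((expR t * expR (- x / 2))%R%:E * 2%:E))%E).
  apply: ge0_le_integral => //.
  - by move=> x _; rewrite (layer_cake_indic false (mab x) (mYt t0) (Y0 t0));
      exact: integral_ge0.
  - by apply: measurable_funTS; apply: measurable_cut => //; [exact: mYt|exact: mYt|exact: Y0].
  - by apply: measurable_funTS; apply: emeasurable_funM => //;
      apply/measurable_EFinP/measurable_funM => //; exact/measurable_EFinP.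
  move=> x; rewrite /= in_itv/= andbT => x0.
  rewrite (layer_cake_indic false)//; [|exact: mYt|exact: Y0].
  rewrite -integral_expR_half -ge0_integralZl//; last exact: measurable_funTS.
  apply: ge0_le_integral => //.
  - by apply: measurable_funTS; apply: measurable_P_above => //; exact: mYt.
  - by apply: measurable_funTS; exact: measurable_funeM.
  by move=> y; rewrite /= in_itv/= andbT => y0; exact: key.
under eq_integral do rewrite EFinM -muleA (muleC _ 2%:E) muleA.
rewrite ge0_integralZl//; last exact: measurable_funTS.
by rewrite integral_expR_half -!EFinM ltry.
Qed.

End inverse_moments.

Section inverse_scaling.
Set Implicit Arguments.
Unset Strict Implicit.
Context d (T : measurableType d) (R : realType) (P : probability T R).
Variables (alpha : R) (D Y : R -> T -> R).
Hypotheses (alpha01 : 0 < alpha < 1) (DP : stable_subordinator P alpha D).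
Hypothesis mY : stochastic_process Y.
Hypothesis YD : {ae P, forall w, forall t : R, 0 <= t ->
  Y t w = inf [set x | 0 < x /\ t < D x w]}.

Let mYt t : 0 <= t -> measurable_fun setT (Y t). Proof. exact: mY. Qed.
Let Y0 t : 0 <= t -> {ae P, forall w, 0 <= Y t w}.
Proof. exact: (inverse_ge0 DP YD). Qed.

Lemma inverse_square_mean t : 0 <= t -> exists a, has_mean P (fun w => Y t w * Y t w) a.
Proof.
move=> t0; exists (fine (\int[P]_w (Y t w * Y t w)%:E)%E).
apply: mean_ge0; first by apply: measurable_funM; exact: mYt.
  by apply: filterS (Y0 t0) => w h; rewrite mulr_ge0.
rewrite fineK// ge0_fin_numE; first exact: (inverse_square_finite DP mY YD).
rewrite (layer_cake_mul false (mYt t0) (Y0 t0) (mYt t0) (Y0 t0)).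
apply: integral_ge0 => x _.
rewrite (layer_cake_indic false _ (mYt t0) (Y0 t0)); last first.
  by apply: measurable_above; exact: mYt.
exact: integral_ge0.
Qed.

Lemma inverse_mean t : 0 <= t -> exists a, has_mean P (Y t) a.
Proof.
move=> t0; have [a ma] := inverse_square_mean t0.
apply: (mean_dominated (mYt t0) _ (meanD (mean_cst P 1) ma)).
by apply: filterS (Y0 t0) => w h; rewrite h/=; nra.
Qed.

Lemma inverse_mul_mean s t : 0 <= s -> 0 <= t ->
  exists a, has_mean P (fun w => Y s w * Y t w) a.
Proof.
move=> s0 t0; have [a ma] := inverse_square_mean s0.
have [b mb] := inverse_square_mean t0.
apply: (mean_dominated _ _ (meanD ma mb)).
  by apply: measurable_funM; exact: mYt.
by apply: filterS2 (Y0 s0) (Y0 t0) => w h1 h2; rewrite mulr_ge0//=; nra.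
Qed.

Section scaling.
Variable t : R.
Hypothesis t0 : 0 < t.
Local Notation ta := (t `^ alpha).

Let t0' : 0 <= t. Proof. exact: ltW. Qed.
Let ta0 : 0 < ta. Proof. exact: powR_gt0. Qed.

(** [Z] has the law of [Y t], by the scaling of the subordinator; the two
    inclusions below, up to boundary cases, suffice to compare moments. *)
Let Z w := ta * Y 1 w.

Let aboveZ b x : above b Z x = above b (Y 1) (x / ta).
Proof.
by apply/seteqP; split => w; rewrite /above /Z/=; case: b => /=;
  rewrite ?ltr_pdivrMr ?ler_pdivrMr// mulrC.
Qed.

Let mZ : measurable_fun setT Z.
Proof. by apply: measurable_funM => //; exact: mYt. Qed.

Let Z0 : {ae P, forall w, 0 <= Z w}.
Proof. by apply: filterS (Y0 ler01) => w h; rewrite mulr_ge0// ltW. Qed.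

Let YZ x : 0 <= x -> (P (above false (Y t) x) <= P (above true Z x))%E.
Proof.
move=> x0; apply: (le_trans (above_below1 DP mY YD t0' x0)).
rewrite (below_scaling DP t0 x0) aboveZ.
by apply: (below_above1 DP mY YD ler01); rewrite divr_ge0// ltW.
Qed.

Let ZY x : 0 <= x -> (P (above false Z x) <= P (above true (Y t) x))%E.
Proof.
move=> x0; apply: le_trans (below_above1 DP mY YD t0' x0).
rewrite (below_scaling DP t0 x0) aboveZ.
by apply: (above_below1 DP mY YD ler01); rewrite divr_ge0// ltW.
Qed.

Lemma inverse_mean_scaling m : has_mean P (Y 1) m -> has_mean P (Y t) (ta * m).
Proof.
move=> /(meanZ ta) mZm; apply: mean_ge0 => //; [exact: mYt|exact: Y0|].
rewrite -mZm.2; apply/eqP; rewrite eq_le; apply/andP; split.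
  apply: (le_expectation_of_above (b := false) (c := true)) => //; [exact: mYt|exact: Y0].
apply: (le_expectation_of_above (b := false) (c := true)) => //; [exact: mYt|exact: Y0].
Qed.

Let above_max b (F : T -> R) x y :
  above b F x `&` above b F y = above b F (Num.max x y).
Proof.
apply/seteqP; split => w; rewrite /above/=; case: b => /=.
- by move=> [h1 h2]; rewrite ge_max h1.
- by move=> [h1 h2]; rewrite gt_max h1.
- by rewrite ge_max => /andP[].
- by rewrite gt_max => /andP[].
Qed.

Lemma inverse_square_mean_scaling m : has_mean P (fun w => Y 1 w * Y 1 w) m ->
  has_mean P (fun w => Y t w * Y t w) (ta ^+ 2 * m).
Proof.
move=> /(meanZ (ta ^+ 2)) mZm; apply: mean_ge0.
- by apply: measurable_funM; exact: mYt.
- by apply: filterS (Y0 t0') => w h; rewrite mulr_ge0.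
rewrite -mZm.2 [RHS](_ : _ = \int[P]_w (Z w * Z w)%:E)%E; last first.
  by apply: eq_integral => w _; congr EFin; rewrite /Z expr2; ring.
apply/eqP; rewrite eq_le; apply/andP; split;
  apply: (le_expectation_mul_of_above (b := false) (c := true)) => //;
  do ?[exact: mYt|exact: Y0]; move=> x y x0 y0; rewrite !above_max.
  by apply: YZ; rewrite le_max x0.
by apply: ZY; rewrite le_max x0.
Qed.

End scaling.

(** Otherwise [D x > 1] almost surely, so [exp (- x s ^ alpha) <= exp (- s)] for
    all [s > 0], which fails for large [s] because [alpha < 1]. *)
Lemma below_gt0 x : 0 <= x -> (0 < P (below D x 1))%E.
Proof.
move=> x0; rewrite lt0e measure_ge0 andbT; apply/eqP => Px.
have /andP[a0 a1] := alpha01.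
have D1 : {ae P, forall w, 1 < D x w}.
  exists (below D x 1); split => //; first exact: (measurable_below DP).
  by move=> w /= /negP; rewrite -leNgt.
have le s : 0 < s -> s <= x * s `^ alpha.
  move=> s0; have := mean_le (laplace_subordinator_mean DP s0 x0) (mean_cst P (expR (- s))).
  rewrite ler_expR mulNr lerN2; apply.
  apply: filterS D1 => w D1; rewrite ler_expR mulNr lerN2.
  by rewrite -[leLHS]mulr1 ler_pM2l// ltW.
(* Chosen so that [s = (x + 1) * s `^ alpha]. *)
pose s := (x + 1) `^ (1 - alpha)^-1.
have s0 : 0 < s by apply: powR_gt0; exact: ltr_wpDl.
have e : s = (x + 1) * s `^ alpha.
  have -> : x + 1 = s `^ (1 - alpha).
    rewrite -powRrM mulVf ?powRr1//; first by rewrite addr_ge0.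
    by rewrite subr_eq0 gt_eqF.
  by rewrite -powRD ?subrK ?powRr1 ?(ltW s0)// (gt_eqF s0) implybT.
have := le s s0; rewrite leNgt => /negP; apply.
by rewrite [ltRHS]e ltr_pM2r ?ltrDl//; exact: powR_gt0.
Qed.

(** [Y 1] reaches any level [x] with at least the probability of [D x <= 1]. *)
Lemma inverse_not_constant a : ~ {ae P, forall w, Y 1 w = a}.
Proof.
move=> h; pose x := Num.max 0 (a + 1).
have x0 : 0 <= x by rewrite le_max lexx.
have := lt_le_trans (below_gt0 x0) (below_above1 DP mY YD ler01 x0).
have m : measurable (above true (Y 1) x) by apply: measurable_above; exact: mYt.
rewrite (@eq_probability_ae _ _ _ _ _ set0) ?measure0 ?ltxx//.
apply: filterS h => w Yw; split => //; rewrite /above/= Yw /x ge_max => /andP[_].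
by rewrite gerDl ler10.
Qed.

Lemma inverse_variance_gt0 m1 m2 : has_mean P (Y 1) m1 ->
  has_mean P (fun w => Y 1 w * Y 1 w) m2 -> 0 < m1 /\ m1 ^+ 2 < m2.
Proof.
move=> e1 e2; split.
  rewrite lt0r (mean_ge0_le e1 (Y0 ler01)) andbT; apply/eqP => m0.
  by apply: (@inverse_not_constant 0); apply: mean_eq0_ae (Y0 ler01); rewrite -m0.
rewrite ltNge; apply/negP => le.
have e3 : has_mean P (fun w => (Y 1 w - m1) ^+ 2) (m2 - m1 ^+ 2).
  rewrite (_ : m2 - m1 ^+ 2 = m2 - (2 * m1) * m1 + m1 ^+ 2); last by ring.
  have := meanD (meanB e2 (meanZ (2 * m1) e1)) (mean_cst P (m1 ^+ 2)).
  apply: mean_ae.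
    by apply: measurable_funX; apply: measurable_funB => //; exact: mYt.
  by apply: aeW => w /=; ring.
have sq0 : {ae P, forall w, 0 <= (Y 1 w - m1) ^+ 2} by apply: aeW => w; exact: sqr_ge0.
have e0 : m2 - m1 ^+ 2 = 0.
  by apply/eqP; rewrite eq_le subr_le0 le (mean_ge0_le e3 sq0).
rewrite e0 in e3.
apply: (@inverse_not_constant m1); apply: filterS (mean_eq0_ae e3 sq0) => w /eqP.
by rewrite sqrf_eq0 subr_eq0 => /eqP.
Qed.

End inverse_scaling.

(** * Covariance of the inverse stable subordinator *)

Section inverse_covariance.
Set Implicit Arguments.
Unset Strict Implicit.
Context d (T : measurableType d) (R : realType) (P : probability T R).
Variables (alpha : R) (D Y : R -> T -> R).
Hypotheses (DP : stable_subordinator P alpha D).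
Hypothesis mY : stochastic_process Y.
Hypothesis YD : {ae P, forall w, forall t : R, 0 <= t ->
  Y t w = inf [set x | 0 < x /\ t < D x w]}.
Local Notation mu := (@lebesgue_measure R).

Let mYt t : 0 <= t -> measurable_fun setT (Y t). Proof. exact: mY. Qed.
Let Y0 t : 0 <= t -> {ae P, forall w, 0 <= Y t w}.
Proof. exact: (inverse_ge0 DP YD). Qed.

(** As [D x >= 0], the increment [D (x + y) - D x] is also at most [t]; it is
    independent of [D x] and has the law of [D y]. *)
Lemma below_joint_le s t x y : 0 <= x -> 0 <= y ->
  (P (below D x s `&` below D (x + y) t) <= P (below D x s) * P (below D y t))%E.
Proof.
move=> x0 y0; have [LD _ _] := DP; have xxy : x <= x + y by rewrite lerDl.
have mI (r : R) : measurable [set z : R | z <= r] by rewrite -set_itvNyc; exact: measurable_itv.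
have := levy_markov LD x0 xxy (mI s) (mI t).
rewrite (_ : x + y - x = y); last by ring.
move=> <-; apply: le_probability_ae.
- apply: measurableI; apply: (measurable_below DP) => //; exact: addr_ge0.
- apply: measurableI; first exact: (measurable_below DP).
  have : measurable_fun setT (fun w => D (x + y) w - D x w).
    by apply: measurable_funB; apply: (measurable_subordinator DP) => //; exact: addr_ge0.
  by move=> /(_ measurableT _ (mI t)); rewrite setTI.
apply: filterS (subordinator_ge0 DP) => w D0 [h1 h2]; split => //=.
by move: h2 (D0 x x0); rewrite /below/=; lra.
Qed.

(** [D x <= s] and [D (x + y) - D x <= t - s] add up to [D (x + y) <= t]. *)
Lemma below_joint_ge s t x y : 0 <= x -> 0 <= y ->
  (P (below D x s) * P (below D y (t - s)%R) <= P (below D x s `&` below D (x + y) t))%E.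
Proof.
move=> x0 y0; have [LD _ _] := DP; have xxy : x <= x + y by rewrite lerDl.
have mI (r : R) : measurable [set z : R | z <= r] by rewrite -set_itvNyc; exact: measurable_itv.
have := levy_markov LD x0 xxy (mI s) (mI (t - s)).
rewrite (_ : x + y - x = y); last by ring.
move=> <-; apply: le_measure; rewrite ?inE.
- apply: measurableI; first exact: (measurable_below DP).
  have : measurable_fun setT (fun w => D (x + y) w - D x w).
    by apply: measurable_funB; apply: (measurable_subordinator DP) => //; exact: addr_ge0.
  by move=> /(_ measurableT _ (mI (t - s))); rewrite setTI.
- apply: measurableI; apply: (measurable_below DP) => //; exact: addr_ge0.
by move=> w [h1 h2]; split => //; move: h1 h2; rewrite /below/=; lra.
Qed.

Let overshoot t x w := Num.max (Y t w - x) 0.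

Let mover t x : 0 <= t -> measurable_fun setT (overshoot t x).
Proof.
move=> t0; apply: measurable_maxr => //; apply: measurable_funB => //.
exact: mYt.
Qed.

Let over0 t x : {ae P, forall w, 0 <= overshoot t x w}.
Proof. by apply: aeW => w; rewrite le_max lexx orbT. Qed.

(** Where [Y s] passes [x], so does [Y t], which is then [x] plus its overshoot. *)
Lemma inverse_cut b s t x : 0 <= s -> s <= t -> 0 <= x ->
  (\int[P]_w ((\1_(above b (Y s) x) w)%:E * (Y t w)%:E) =
   x%:E * P (above b (Y s) x) +
   \int[mu]_(y in `[0%R, +oo[) P (above b (Y s) x `&` above b (overshoot t x) y))%E.
Proof.
move=> s0 st x0; have t0 := le_trans s0 st.
have mA : measurable (above b (Y s) x) by apply: measurable_above; exact: mYt.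
rewrite -(layer_cake_indic b mA (mover x t0) (over0 t x)).
have <- : (\int[P]_w (\1_(above b (Y s) x) w)%:E = P (above b (Y s) x))%E.
  by rewrite integral_indic// setIT.
rewrite -ge0_integralZl//; last exact/measurable_EFinP.
have m1 : measurable_fun setT (fun w => (\1_(above b (Y s) x) w : R)%:E).
  exact/measurable_EFinP.
have m2 : measurable_fun setT (fun w => (overshoot t x w)%:E).
  exact/measurable_EFinP/mover.
rewrite -ge0_integralD//; first last.
- exact: emeasurable_funM.
- by move=> w _; rewrite mule_ge0 ?lee_fin// le_max lexx orbT.
- exact: measurable_funeM.
- by move=> w _; rewrite mule_ge0 ?lee_fin.
apply: ae_eq_integral => //.
- by apply: emeasurable_funM => //; exact/measurable_EFinP/mYt.
- by apply: emeasurable_funD; [exact: measurable_funeM|exact: emeasurable_funM].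
apply: filterS (inverse_nondecreasing DP YD s0 st) => w Yst _.
rewrite indicE; case: (boolP (w \in _)) => [|_]; last by rewrite mule0 !mul0e adde0.
rewrite inE /above/= => h; rewrite mule1 !mul1e -EFinD; congr EFin.
have xY : x <= Y t w by apply: le_trans Yst; case: b h {mA m1} => //= /ltW.
by rewrite /overshoot max_l ?subr_ge0// addrC subrK.
Qed.

Let mP b s : 0 <= s -> measurable_fun setT (fun x : R => P (above b (Y s) x)).
Proof. by move=> s0; apply: measurable_P_above1; exact: mYt. Qed.

Let mxP b s : 0 <= s -> measurable_fun setT (fun x : R => x%:E * P (above b (Y s) x))%E.
Proof. by move=> s0; apply: emeasurable_funM; [exact/measurable_EFinP|exact: mP]. Qed.

Let cut_ge0 b s t x : 0 <= s -> 0 <= t ->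
  (0 <= \int[P]_w ((\1_(above b (Y s) x) w)%:E * (Y t w)%:E))%E.
Proof.
move=> s0 t0; rewrite (layer_cake_indic b _ (mYt t0) (Y0 t0)).
  exact: integral_ge0.
by apply: measurable_above; exact: mYt.
Qed.

(** By the layer-cake formula, this is half the second moment of [Y s]. *)
Let J s := (\int[mu]_(x in `[0%R, +oo[) (x%:E * P (above false (Y s) x)))%E.

Let J_ge0 s : (0 <= J s)%E.
Proof.
by apply: integral_ge0 => x; rewrite /= in_itv/= andbT => x0; rewrite mule_ge0.
Qed.

(** After time [x] the subordinator restarts from a nonnegative level, so it
    exceeds [t] no later than an independent copy restarting from 0. *)
Lemma cut_le s t x : 0 <= s -> s <= t -> 0 <= x ->
  (\int[P]_w ((\1_(above false (Y s) x) w)%:E * (Y t w)%:E) <=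
   x%:E * P (above false (Y s) x) + P (above true (Y s) x) * \int[P]_w (Y t w)%:E)%E.
Proof.
move=> s0 st x0; have t0 := le_trans s0 st.
rewrite inverse_cut// leeD2l// (layer_cake1 true (mYt t0) (Y0 t0)).
have mA b : measurable (above b (Y s) x) by apply: measurable_above; exact: mYt.
rewrite -ge0_integralZl//; last by apply: measurable_funTS; exact: mP.
apply: ge0_le_integral => //.
- by apply: measurable_funTS; apply: measurable_P_above => //; exact: mover.
- by apply: measurable_funTS; apply: measurable_funeM; exact: mP.
move=> y; rewrite /= in_itv/= andbT => y0.
apply: (@le_trans _ _ (P (above false (Y s) x `&` above false (Y t) (x + y)))).
  apply: le_measure; rewrite ?inE.
  - by apply: measurableI => //; apply: measurable_above; exact: mover.
  - by apply: measurableI => //; apply: measurable_above; exact: mYt.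
  move=> w [h1]; rewrite /above/= /overshoot lt_max (ltNge y 0) y0 orbF => h2.
  by split => //; rewrite addrC -ltrBrDr.
apply: (le_trans (above_below DP mY YD s0 t0 x0 (addr_ge0 x0 y0))).
apply: (le_trans (below_joint_le s t x0 y0)).
by apply: lee_pmul => //; exact: (below_above1 DP mY YD).
Qed.

(** Where [Y s] passes [x] the subordinator restarts from a level at most [s], so
    it exceeds [t] no sooner than an independent copy exceeds [t - s]. *)
Lemma cut_ge s t x : 0 <= s -> s <= t -> 0 <= x ->
  (x%:E * P (above false (Y s) x) +
     P (above false (Y s) x) * \int[P]_w (Y (t - s)%R w)%:E <=
   \int[P]_w ((\1_(above true (Y s) x) w)%:E * (Y t w)%:E))%E.
Proof.
move=> s0 st x0; have t0 := le_trans s0 st.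
have ts0 : 0 <= t - s by rewrite subr_ge0.
have mA b : measurable (above b (Y s) x) by apply: measurable_above; exact: mYt.
rewrite inverse_cut//; apply: leeD.
  apply: lee_wpmul2l => //; apply: le_measure; rewrite ?inE//.
  by move=> w /= /ltW.
rewrite (layer_cake1 false (mYt ts0) (Y0 ts0)).
rewrite -ge0_integralZl//; last by apply: measurable_funTS; exact: mP.
apply: ge0_le_integral => //.
- by move=> y _; exact: mule_ge0.
- by apply: measurable_funTS; apply: measurable_funeM; exact: mP.
- by apply: measurable_funTS; apply: measurable_P_above => //; exact: mover.
move=> y; rewrite /= in_itv/= andbT => y0.
apply: (@le_trans _ _ (P (above true (Y s) x `&` above true (Y t) (x + y)))); last first.
  apply: le_measure; rewrite ?inE.
  - by apply: measurableI => //; apply: measurable_above; exact: mYt.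
  - by apply: measurableI => //; apply: measurable_above; exact: mover.
  move=> w [h1]; rewrite /above/= /overshoot => h2.
  by split => //=; rewrite le_max lerBrDr addrC h2.
apply: (le_trans _ (below_above DP mY YD s0 t0 x0 (addr_ge0 x0 y0))).
apply: (le_trans _ (below_joint_ge s t x0 y0)).
by apply: lee_pmul => //; exact: (above_below1 DP mY YD).
Qed.

(** Both bounds come from integrating [cut_le] and [cut_ge] over [x]. They differ
    by [us * (ut - uts)], which vanishes as [t] grows if [alpha < 1]: then [j]
    is the limit of the covariance of [Y s] and [Y t]. *)
Lemma inverse_mul_bounds s : 0 <= s -> exists2 j, 0 <= j &
  forall t us ut uts g, s <= t -> has_mean P (Y s) us -> has_mean P (Y t) ut ->
    has_mean P (Y (t - s)) uts -> has_mean P (fun w => Y s w * Y t w) g ->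
    j + us * uts <= g <= j + us * ut.
Proof.
move=> s0.
have up t us ut g : s <= t -> has_mean P (Y s) us -> has_mean P (Y t) ut ->
    has_mean P (fun w => Y s w * Y t w) g -> (g%:E <= J s + (us * ut)%:E)%E.
  move=> st [_ e1] [_ e2] [_ <-]; have t0 := le_trans s0 st.
  rewrite (layer_cake_mul false (mYt s0) (Y0 s0) (mYt t0) (Y0 t0)).
  rewrite EFinM -e1 (layer_cake1 true (mYt s0) (Y0 s0)).
  have ut0 : (0 <= ut%:E)%E.
    by rewrite -e2 (layer_cake1 true (mYt t0) (Y0 t0)); exact: integral_ge0.
  rewrite -ge0_integralZr//; last by apply: measurable_funTS; exact: mP.
  rewrite /J -ge0_integralD//; first last.
  - by apply: measurable_funTS; apply: emeasurable_funM => //; exact: mP.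
  - by move=> x _; exact: mule_ge0.
  - by apply: measurable_funTS; exact: mxP.
  - by move=> x; rewrite /= in_itv/= andbT => x0; rewrite mule_ge0.
  apply: ge0_le_integral => //.
  - by move=> x _; exact: cut_ge0.
  - by apply: measurable_funTS; apply: measurable_cut; [exact: mYt|exact: mYt|exact: Y0].
  - apply: measurable_funTS; apply: emeasurable_funD; first exact: mxP.
    by apply: emeasurable_funM => //; exact: mP.
  move=> x; rewrite /= in_itv/= andbT => x0.
  by have := cut_le s0 st x0; rewrite e2.
have lo t us uts g : s <= t -> has_mean P (Y s) us -> has_mean P (Y (t - s)) uts ->
    has_mean P (fun w => Y s w * Y t w) g -> (J s + (us * uts)%:E <= g%:E)%E.
  move=> st [_ e1] [_ e2] [_ <-]; have t0 := le_trans s0 st.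
  have ts0 : 0 <= t - s by rewrite subr_ge0.
  rewrite (layer_cake_mul true (mYt s0) (Y0 s0) (mYt t0) (Y0 t0)).
  rewrite EFinM -e1 (layer_cake1 false (mYt s0) (Y0 s0)).
  have ut0 : (0 <= uts%:E)%E.
    by rewrite -e2 (layer_cake1 true (mYt ts0) (Y0 ts0)); exact: integral_ge0.
  rewrite -ge0_integralZr//; last by apply: measurable_funTS; exact: mP.
  rewrite /J -ge0_integralD//; first last.
  - by apply: measurable_funTS; apply: emeasurable_funM => //; exact: mP.
  - by move=> x _; exact: mule_ge0.
  - by apply: measurable_funTS; exact: mxP.
  - by move=> x; rewrite /= in_itv/= andbT => x0; rewrite mule_ge0.
  apply: ge0_le_integral => //.
  - by move=> x; rewrite /= in_itv/= andbT => x0; rewrite adde_ge0 ?mule_ge0.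
  - apply: measurable_funTS; apply: emeasurable_funD; first exact: mxP.
    by apply: emeasurable_funM => //; exact: mP.
  - by apply: measurable_funTS; apply: measurable_cut; [exact: mYt|exact: mYt|exact: Y0].
  move=> x; rewrite /= in_itv/= andbT => x0.
  by have := cut_ge s0 st x0; rewrite e2.
have [us mus] := inverse_mean DP mY YD s0.
have [g mg] := inverse_mul_mean DP mY YD s0 s0.
have ss0 : 0 <= s - s by rewrite subrr.
have [uz muz] := inverse_mean DP mY YD ss0.
have Jfin : J s \is a fin_num.
  rewrite ge0_fin_numE//; apply: le_lt_trans (ltry g).
  apply: le_trans (lo _ _ _ _ (lexx s) mus muz mg).
  rewrite leeDl// lee_fin mulr_ge0//; first exact: mean_ge0_le mus (Y0 s0).
  exact: mean_ge0_le muz (Y0 ss0).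
exists (fine (J s)); first exact: fine_ge0.
move=> t us' ut uts g' st h1 h2 h3 h4; rewrite -!lee_fin !EFinD fineK//.
by rewrite (lo _ _ _ _ st h1 h3 h4) (up _ _ _ _ st h1 h2 h4).
Qed.

End inverse_covariance.

(** * Subordination by an independent time change *)

Section monotone_paths.
Set Implicit Arguments.
Unset Strict Implicit.
Context d (T : measurableType d) (R : realType) (P : probability T R).

Lemma right_limit_rational (f : R -> R) (u v e : R) : u < v -> 0 < e ->
  f x @[x --> u^'+] --> f u ->
  exists q : rat, u < ratr q < v /\ `|f u - f (ratr q)| < e.
Proof.
move=> uv e0 /cvgrPdist_lt /(_ e e0).
rewrite near_withinE near_nbhs /nbhs/= => -[r r0 hr].
have uvr : u < Num.min v (u + r) by rewrite lt_min uv ltrDl.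
have [q] := rat_in_itvoo uvr; rewrite in_itv/= lt_min => /and3P[uq qv qr].
exists q; rewrite uq qv; split => //; apply: hr => //=.
by rewrite /ball/= distrC ger0_norm ?subr_ge0 1?ltW// ltrBlDl.
Qed.

(** Almost surely, monotonicity holds along the countably many rational times; it
    extends to all times by right continuity. *)
Lemma poisson_paths_nondecreasing (rate : R) (N : R -> T -> nat) :
  0 < rate -> Poisson_process P rate N ->
  {ae P, forall w, forall u v, 0 <= u -> u <= v -> (N u w <= N v w)%N}.
Proof.
move=> rate0 NP; have [_ [_ _ _ _ cad] _] := NP.
have rational : {ae P, forall w, forall q q' : rat, 0 <= ratr q :> R -> q <= q' ->
    (N (ratr q) w <= N (ratr q') w)%N}.
  pose Q (n : nat) (w : T) := if unpickle n is Some (q, q') then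
    0 <= ratr q :> R -> q <= q' -> (N (ratr q) w <= N (ratr q') w)%N else True.
  have : {ae P, forall w, forall n, Q n w}.
    apply: ae_foralln => n; rewrite /Q; case: unpickle => [[q q']|]; last exact: aeW.
    have [q0|q0] := boolP (0 <= ratr q :> R); last by apply: aeW => w.
    have [qq|qq] := boolP (q <= q'); last by apply: aeW => w.
    have qq' : ratr q <= ratr q' :> R by rewrite ler_rat.
    by apply: filterS (poisson_process_nondecreasing NP q0 qq').
  by apply: filterS => w h q q'; have := h (pickle (q, q')); rewrite /Q pickleK.
apply: filterS2 cad rational => w [rc _] hq u v u0.
rewrite le_eqVlt => /predU1P[->//|uv].
(* Errors below 1/2 at both ends cannot hide a difference between integers. *)
have half : 0 < 2^-1 :> R by rewrite invr_gt0.
have [q [/andP[uq qv] Nq]] := right_limit_rational uv half (rc u u0).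
have v1 : v < v + 1 by rewrite ltrDl.
have [q' [/andP[vq' _] Nq']] := right_limit_rational v1 half (rc v (le_trans u0 (ltW uv))).
have qq : q <= q' by rewrite -(ler_rat R) ltW// (lt_trans qv).
have := hq q q' (le_trans u0 (ltW uq)) qq.
rewrite -(ler_nat R) => qq'; rewrite -ltnS -(ltr_nat R) -natr1.
move: Nq Nq'; rewrite !ltr_norml => /andP[_ h1] /andP[h2 _]; lra.
Qed.

End monotone_paths.

Section subordination.
Set Implicit Arguments.
Unset Strict Implicit.
Context d (T : measurableType d) (R : realType) (P : probability T R).
Variables (M Y : R -> T -> R) (s t : R).
Hypotheses (s0 : 0 <= s) (t0 : 0 <= t).
Hypothesis MY : independent_families P (@times R) M (@times R) Y.
Hypotheses (mM : forall u, 0 <= u -> measurable_fun setT (M u))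
  (mY : stochastic_process Y).
Hypotheses (Ys0 : {ae P, forall w, 0 <= Y s w})
  (Yst : {ae P, forall w, Y s w <= Y t w}).
Variables (G : R -> R -> T -> R) (a b : R).
Hypotheses (a0 : 0 <= a) (b0 : 0 <= b).
Hypothesis mG : forall u v, 0 <= u -> 0 <= v -> measurable_fun setT (G u v).
Hypothesis mgenG : forall u v, 0 <= u -> 0 <= v ->
  measurable_fun (setT : set (g_sigma_algebraType (generators (@times R) M))) (G u v).
Hypothesis G0 : forall u v w, 0 <= G u v w.
Hypothesis Gmono : {ae P, forall w, forall u u' v v', 0 <= u -> u <= u' ->
  0 <= v -> v <= v' -> G u v w <= G u' v' w}.
Hypothesis Gmean : forall u v, 0 <= u -> u <= v -> has_mean P (G u v) (a * u + b * (u * v)).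
Variable H : T -> R.
Hypotheses (mH : measurable_fun setT H) (HG : {ae P, forall w, H w = G (Y s w) (Y t w) w}).
Variables (us ut g : R).
Hypotheses (mus : has_mean P (Y s) us) (mut : has_mean P (Y t) ut)
  (mg : has_mean P (fun w => Y s w * Y t w) g).

Section grid.
Variable h : R.
Hypothesis h0 : 0 < h.

Let cell r w := Num.truncn (Y r w / h).
(** Rounding a time to the grid of mesh [h] uses the index of its cell, with
    [c = 0] to round down and [c = 1] to round up. *)
Let point (c n : nat) : R := h * (n + c)%:R.

Let point_ge0 c n : 0 <= point c n. Proof. by rewrite mulr_ge0// ltW. Qed.

Let measurable_cell n : measurable [set x : R | Num.truncn (x / h) = n].
Proof.
rewrite (_ : [set x | _] = [set x | n%:R * h <= x \/ n = 0%N] `&` [set x | x < n.+1%:R * h]).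
  apply: measurableI; last by rewrite -set_itvNyo; exact: measurable_itv.
  case: n => [|n].
    rewrite (_ : [set x | _] = setT); first exact: measurableT.
    by apply/seteqP; split => // x _; right.
  rewrite (_ : [set x | _] = `[n.+1%:R * h, +oo[%classic); first exact: measurable_itv.
  by rewrite set_itvcy; apply/seteqP; split => x /=; [case|left].
apply/seteqP; split => x /=.
  move=> <-; split; last by rewrite -ltr_pdivrMr// truncnS_gt.
  case E : (Num.truncn (x / h)) => [|m]; [by right|left].
  by rewrite -ler_pdivlMr// -truncn_gt_nat E.
move=> [h1]; rewrite -ltr_pdivrMr// => h2; apply/eqP; rewrite eqn_leq; apply/andP; split.
  by rewrite leqNgt truncn_gt_nat -ltNge.
case: n h1 {h2} => // n [|//]; rewrite -ler_pdivlMr// => h1.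
by rewrite truncn_gt_nat.
Qed.

Let gen_cell r n : 0 <= r -> generated_sigma (@times R) Y [set w | cell r w = n].
Proof. by move=> r0; exact: (@generated_preimage _ _ _ _ _ _ Y r _ r0 (measurable_cell n)). Qed.

Let cell_pair (p : nat * nat) : generated_sigma (@times R) Y
  [set w | (cell s w, cell t w) = p].
Proof.
rewrite (_ : [set w | _] = [set w | cell s w = p.1] `&` [set w | cell t w = p.2]).
  exact: (@measurableI _ (g_sigma_algebraType (generators (@times R) Y)) _ _
    (gen_cell _ s0) (gen_cell _ t0)).
by apply/seteqP; split => w /=; case: p => i j //= [-> ->].
Qed.

Let mcell_pair (p : nat * nat) : measurable [set w | (cell s w, cell t w) = p].
Proof.
have mc r n : 0 <= r -> measurable [set w | cell r w = n].
  by move=> r0; have := mY r0 measurableT (measurable_cell n); rewrite setTI.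
rewrite (_ : [set w | _] = [set w | cell s w = p.1] `&` [set w | cell t w = p.2]).
  by apply: measurableI; exact: mc.
by apply/seteqP; split => w /=; case: p => i j //= [-> ->].
Qed.

Let cell_bounds r w : 0 <= Y r w ->
  point 0 (cell r w) <= Y r w <= point 1 (cell r w).
Proof.
move=> Y0; have /andP[h1 h2] : (cell r w)%:R <= Y r w / h < (cell r w).+1%:R.
  by apply: truncn_itv; rewrite divr_ge0// ltW.
rewrite /point addn0 addn1 ![h * _]mulrC; rewrite -ler_pdivlMr// h1/=.
by rewrite -ler_pdivrMr// ltW.
Qed.

Let point1E n : point 1 n = point 0 n + h.
Proof. by rewrite /point addn0 natrD mulrDr mulr1. Qed.

(** At rounded times, only countably many of the [G u v] are involved. *)
Let W c w := G (point c (cell s w)) (point c (cell t w)) w.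

(** The mean of [G u v], at the rounded times. *)
Let rho c w := a * point c (cell s w) +
  b * (point c (cell s w) * point c (cell t w)).

Let mW c : measurable_fun setT (W c).
Proof.
apply/measurable_EFinP.
apply: (@measurable_random_index _ _ _ _ (fun w => (cell s w, cell t w)) mcell_pair
  (fun p w => (G (point c p.1) (point c p.2) w)%:E)).
by move=> p; apply/measurable_EFinP; exact: mG.
Qed.

Let mrho c : measurable_fun setT (rho c).
Proof.
apply/measurable_EFinP.
apply: (@measurable_random_index _ _ _ _ (fun w => (cell s w, cell t w)) mcell_pair
  (fun p w => (a * point c p.1 + b * (point c p.1 * point c p.2))%:E)).
by move=> p.
Qed.

Let Wmean c r : has_mean P (rho c) r -> has_mean P (W c) r.
Proof.
case=> _ er; apply: mean_ge0 => //; first by apply: aeW => w; exact: G0.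
have := @expectation_random_index _ _ _ P _ (fun w => (cell s w, cell t w)) mcell_pair
  (fun p w => G (point c p.1) (point c p.2) w).
move=> /(_ _ _ _) ->; first last.
- move=> p x; rewrite setIC muleC; apply: MY; last exact: cell_pair.
  by apply: generated_above; exact: mgenG.
- by move=> p w; exact: G0.
- by move=> p; exact: mG.
rewrite -er; apply: ae_eq_integral => //.
- exact: (@measurable_random_index _ _ _ _ _ mcell_pair
    (fun p _ => (\int[P]_v (G (point c p.1) (point c p.2) v)%:E)%E)).
- exact/measurable_EFinP.
apply: filterS Yst => w Yw _ /=; rewrite (Gmean _ _).2//.
rewrite ler_pM2l// ler_nat leq_add2r /cell.
have [Yp|Yn] := leP 0 (Y s w / h).
  rewrite truncn_ge_nat; last by apply: le_trans Yp _; rewrite ler_pM2r ?invr_gt0.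
  have /andP[le _] := truncn_itv Yp.
  by rewrite (le_trans le)// ler_pM2r ?invr_gt0.
rewrite (_ : Num.truncn (Y s w / h) = 0%N)//; apply/eqP.
by rewrite -leqn0 leqNgt truncn_gt_nat -ltNge (lt_trans Yn).
Qed.

Let up := a * (us + h) + b * (g + h * (us + ut) + h ^+ 2).
Let lo := a * (us - h) + b * (g - h * (us + ut)).

Let upper_mean : has_mean P (fun w => a * (Y s w + h) + b * ((Y s w + h) * (Y t w + h))) up.
Proof.
have := meanD (meanZ a (meanD mus (mean_cst P h)))
  (meanZ b (meanD (meanD mg (meanZ h (meanD mus mut))) (mean_cst P (h ^+ 2)))).
apply: mean_ae; last by apply: aeW => w /=; ring.
have m r : 0 <= r -> measurable_fun setT (fun w => Y r w + h).
  by move=> r0; apply: measurable_funD => //; exact: mY.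
by apply: measurable_funD; apply: measurable_funM => //;
  [exact: m|apply: measurable_funM; exact: m].
Qed.

Let lower_mean : has_mean P
  (fun w => a * (Y s w - h) + b * (Y s w * Y t w - h * (Y s w + Y t w))) lo.
Proof.
exact: meanD (meanZ a (meanB mus (mean_cst P h)))
  (meanZ b (meanB mg (meanZ h (meanD mus mut)))).
Qed.

Let good : {ae P, forall w, [/\ 0 <= Y s w, Y s w <= Y t w,
  W 0 w <= H w <= W 1 w & rho 1 w <= a * (Y s w + h) + b * ((Y s w + h) * (Y t w + h)) /\
  a * (Y s w - h) + b * (Y s w * Y t w - h * (Y s w + Y t w)) <= rho 0 w]}.
Proof.
apply: filterS2 (filterI Ys0 Yst) (filterI HG Gmono) => w [Y0 Yw] [Hw Gw].
have Yt0 := le_trans Y0 Yw.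
have /andP[s1 s2] := cell_bounds Y0; have /andP[t1 t2] := cell_bounds Yt0.
split => //.
- by rewrite Hw /W; apply/andP; split; apply: Gw.
- rewrite /rho; have ps := point_ge0 0 (cell s w); have pt := point_ge0 0 (cell t w).
  move: s2 t2; rewrite !point1E => s2 t2; split.
    apply: lerD; first by apply: ler_wpM2l => //; lra.
    by apply: ler_wpM2l => //; apply: ler_pM => //; lra.
  apply: lerD; first by apply: ler_wpM2l => //; lra.
  by apply: ler_wpM2l => //; nra.
Qed.

(** By monotonicity of [G], [H] lies between [W 0] and [W 1]; the explicit bounds
    replace the rounded times by [Y s] and [Y t] up to the mesh. *)
Lemma subordination_bounds : exists2 m, has_mean P H m & lo <= m <= up.
Proof.
have rho0 c w : 0 <= rho c w.
  by rewrite /rho addr_ge0// mulr_ge0 ?point_ge0// mulr_ge0 ?point_ge0.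
have [r1 m1] : exists r, has_mean P (rho 1) r.
  apply: mean_dominated upper_mean => //.
  by apply: filterS good => w [_ _ _ [h1 _]]; rewrite rho0.
have [r2 m2] : exists r, has_mean P (rho 0) r.
  apply: mean_dominated m1 => //; apply: aeW => w; rewrite rho0/= /rho !point1E.
  have ps := point_ge0 0 (cell s w); have pt := point_ge0 0 (cell t w).
  apply: lerD; first by rewrite ler_wpM2l// lerDl ltW.
  by rewrite ler_wpM2l// ler_pM// lerDl ltW.
have [m mm] : exists m, has_mean P H m.
  apply: mean_dominated (Wmean m1) => //.
  by apply: filterS good => w [_ _ /andP[h1 h2] _]; rewrite h2 (le_trans _ h1)//; exact: G0.
exists m => //; apply/andP; split.
  apply: (@le_trans _ _ r2).
    by apply: (mean_le lower_mean m2); apply: filterS good => w [_ _ _ []].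
  by apply: (mean_le (Wmean m2) mm); apply: filterS good => w [_ _ /andP[]].
apply: (@le_trans _ _ r1).
  by apply: (mean_le mm (Wmean m1)); apply: filterS good => w [_ _ /andP[]].
by apply: (mean_le m1 upper_mean); apply: filterS good => w [_ _ _ []].
Qed.

End grid.

(** The random times replace [u] and [v] in the mean of [G u v]: the bounds of
    [subordination_bounds] close up as the mesh tends to 0. *)
Lemma subordination_mean : has_mean P H (a * us + b * g).
Proof.
have [m mm _] := subordination_bounds ltr01.
suff -> : a * us + b * g = m by [].
have us0 : 0 <= us by exact: mean_ge0_le mus Ys0.
have ut0 : 0 <= ut.
  by apply: mean_ge0_le mut _; apply: filterS2 Ys0 Yst => w; exact: le_trans.
pose C := a + b * (us + ut + 1).
have C0 : 0 <= C by rewrite addr_ge0// mulr_ge0// !addr_ge0.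
have bound h : 0 < h -> h <= 1 -> `|a * us + b * g - m| <= C * h.
  move=> h0 h1; have [m' mm' /andP[lo up]] := subordination_bounds h0.
  rewrite -(mean_unique mm mm') in lo up; rewrite ler_norml.
  have hh : b * h ^+ 2 <= b * h by rewrite ler_wpM2l// expr2 ler_piMr// ltW.
  have bh : 0 <= b * h by rewrite mulr_ge0// ltW.
  apply/andP; split; rewrite /C; nra.
apply/eqP; rewrite -subr_eq0 -normr_le0; apply/ler_addgt0Pr => e e0; rewrite add0r.
pose h := Num.min 1 (e / (C + 1)).
have C1 : 0 < C + 1 by rewrite ltr_wpDl.
have h0 : 0 < h by rewrite lt_min ltr01 divr_gt0.
have h1 : h <= 1 by rewrite ge_min lexx.
apply: (le_trans (bound h h0 h1)).
apply: (@le_trans _ _ ((C + 1) * h)); first by rewrite ler_wpM2r ?lerDl// ltW.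
by rewrite mulrC -ler_pdivlMr// ge_min lexx orbT.
Qed.

End subordination.

(** * Moments of the fractional process *)

Section asymptotics.
Set Implicit Arguments.
Unset Strict Implicit.
Context (R : realType).

Lemma powRN_cvg0 (p : R) : 0 < p -> t `^ (- p) @[t --> +oo] --> (0 : R).
Proof.
move=> p0; apply/cvgrPdist_le => e e0; near=> t.
have t0 : 0 < t by near: t; exact: nbhs_pinfty_gt.
rewrite sub0r normrN ger0_norm ?powR_ge0// powRN.
rewrite -[leRHS]invrK lef_pV2 ?posrE ?invr_gt0 ?powR_gt0//.
have -> : e^-1 = (e^-1 `^ p^-1) `^ p.
  by rewrite -powRrM mulVf ?gt_eqF// powRr1// invr_ge0 ltW.
by apply: ge0_ler_powR; rewrite ?nnegrE ?powR_ge0 ?(ltW p0) ?(ltW t0).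
Unshelve. all: by end_near. Qed.

(** Concavity is used in the form [1 - s / t <= (1 - s / t) ^ p]. *)
Lemma powR_increment_le (p s t : R) : 0 < p < 1 -> 0 < s < t ->
  0 <= t `^ p - (t - s) `^ p <= s * t `^ (- (1 - p)).
Proof.
move=> /andP[p0 p1] /andP[s0 st]; have t0 := lt_trans s0 st.
have ts0 : 0 < t - s by rewrite subr_gt0.
rewrite subr_ge0; apply/andP; split.
  by apply: ge0_ler_powR; rewrite ?nnegrE ?gerBl//; exact: ltW.
rewrite lerBlDl -lerBlDr.
have -> : t `^ (- (1 - p)) = t `^ p / t.
  rewrite opprB addrC powRD; last by rewrite (gt_eqF t0) implybT.
  by rewrite powR_inv1 ?ltW// mulrC.
have -> : t `^ p - s * (t `^ p / t) = t `^ p * (1 - s / t) by ring.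
have q01 : 0 < 1 - s / t <= 1.
  rewrite subr_gt0 ltr_pdivrMr// mul1r st/=.
  by rewrite gerBl divr_ge0// ltW.
have /andP[q0 q1] := q01.
have {1}-> : t - s = t * (1 - s / t) by rewrite mulrBr mulr1 mulrCA divff ?gt_eqF// mulr1.
rewrite powRM ?(ltW t0) ?(ltW q0)// ler_wpM2l ?powR_ge0//.
by rewrite -[leLHS]powRr1 ?(ltW q0)//; apply: ger_powR => //; exact: ltW.
Qed.

End asymptotics.

Section fractional_moments.
Set Implicit Arguments.
Unset Strict Implicit.
Context d (T : measurableType d) (R : realType) (P : probability T R).
Variables (alpha : R) (k : nat) (lam : 'I_k -> R) (M Y Z : R -> T -> R).
Hypotheses (k0 : (1 <= k)%N) (lam0 : forall j, 0 < lam j).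
Hypotheses (MP : GCP P lam M) (YP : inverse_stable_subordinator P alpha Y).
Hypotheses (MY : independent_families P (@times R) M (@times R) Y).
Hypothesis mZ : stochastic_process Z.
Hypothesis ZE : {ae P, forall w, forall t : R, 0 <= t -> Z t w = M (Y t w) w}.
Local Notation m1 := (total_rate lam * jump_moment lam 1).
Local Notation m2 := (total_rate lam * jump_moment lam 2).

Let m1_ge0 : 0 <= m1.
Proof. by rewrite ltW// mulr_gt0// ?(total_rate_gt0 k0 lam0) ?(jump_moment_gt0 k0 lam0). Qed.

Let m2_ge0 : 0 <= m2.
Proof. by rewrite ltW// mulr_gt0// ?(total_rate_gt0 k0 lam0) ?(jump_moment_gt0 k0 lam0). Qed.

Let mY : stochastic_process Y. Proof. by case: YP. Qed.

Let Y0 t : 0 <= t -> {ae P, forall w, 0 <= Y t w}.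
Proof. by case: YP => _ [D DP YD]; exact: (inverse_ge0 DP YD). Qed.

Let Ymono s t : 0 <= s -> s <= t -> {ae P, forall w, Y s w <= Y t w}.
Proof. by case: YP => _ [D DP YD]; exact: (inverse_nondecreasing DP YD). Qed.

Lemma GCP_ge0 u w : 0 <= M u w.
Proof. by case: MP => N [X [_ _ _ ->]]. Qed.

Lemma measurable_GCP u : 0 <= u -> measurable_fun setT (M u).
Proof. by case: MP => N [X [NP XJ _ ->]]; exact: (measurable_compound NP XJ). Qed.

Lemma GCP_nondecreasing :
  {ae P, forall w, forall u v, 0 <= u -> u <= v -> M u w <= M v w}.
Proof.
case: MP => N [X [NP _ _ ->]].
apply: filterS (poisson_paths_nondecreasing (total_rate_gt0 k0 lam0) NP).
move=> w mono u v u0 uv; rewrite /compound ler_nat.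
rewrite -!(big_mkord xpredT (fun i => X i w)).
by rewrite (big_cat_nat _ (mono u v u0 uv))//= leq_addr.
Qed.

Let mgenM u : 0 <= u ->
  measurable_fun (setT : set (g_sigma_algebraType (generators (@times R) M))) (M u).
Proof. by move=> u0; exact: measurable_fun_generated. Qed.

Lemma GFCP_mean t us : 0 <= t -> has_mean P (Y t) us -> has_mean P (Z t) (m1 * us).
Proof.
move=> t0 mus; have [N [X [NP XJ NX ME]]] := MP.
have [D DP YD] := YP.2; have [g mg] := inverse_square_mean DP mY YD t0.
rewrite -[m1 * us]addr0 -(mul0r g).
apply: (subordination_mean t0 t0 MY mY (Y0 t0) _ m1_ge0 (lexx 0)
  (G := fun u _ => M u) _ _ _ _ _ _ _ mus mus mg).
- exact: aeW.
- by move=> u v u0 _; exact: measurable_GCP.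
- by move=> u v u0 _; exact: mgenM.
- by move=> u v w; exact: GCP_ge0.
- by apply: filterS GCP_nondecreasing => w h u u' v v' u0 uu' _ _; exact: h.
- move=> u v u0 uv; rewrite mul0r addr0 ME.
  exact: (compound_mean k0 lam0 NP XJ NX).
- exact: mZ.
- by apply: filterS ZE => w; exact.
Qed.

Lemma GFCP_mean_mul s t us g : 0 <= s -> s <= t -> has_mean P (Y s) us ->
  has_mean P (fun w => Y s w * Y t w) g ->
  has_mean P (fun w => Z s w * Z t w) (m2 * us + m1 ^+ 2 * g).
Proof.
move=> s0 st mus mg; have t0 := le_trans s0 st.
have [N [X [NP XJ NX ME]]] := MP.
have [D DP YD] := YP.2; have [ut mut] := inverse_mean DP mY YD t0.
apply: (subordination_mean s0 t0 MY mY (Y0 s0) (Ymono s0 st) m2_ge0 (sqr_ge0 m1)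
  (G := fun u v w => M u w * M v w) _ _ _ _ _ _ _ mus mut mg).
- by move=> u v u0 v0; apply: measurable_funM; exact: measurable_GCP.
- by move=> u v u0 v0; apply: measurable_funM; exact: mgenM.
- by move=> u v w; rewrite mulr_ge0 ?GCP_ge0.
- apply: filterS GCP_nondecreasing => w h u u' v v' u0 uu' v0 vv'.
  by rewrite ler_pM ?GCP_ge0 ?h.
- by move=> u v u0 uv; rewrite mulrA ME; exact: (compound_mean_mul k0 lam0 NP XJ NX).
- by apply: measurable_funM; exact: mZ.
- by apply: filterS ZE => w h; rewrite !h.
Qed.

End fractional_moments.

Lemma covariance_mean d (T : measurableType d) (R : realType) (P : probability T R)
    (X Y : T -> R) (x y xy : R) :
  has_mean P X x -> has_mean P Y y -> has_mean P (fun w => X w * Y w) xy ->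
  covariance P X Y = (xy - x * y)%:E.
Proof.
move=> [ix ex] [iy ey] [ixy exy]; rewrite covarianceE; do ?exact/Lfun1_integrable.
rewrite expectation.unlock ex ey -EFinM EFinB; congr (_ - _)%E; exact: exy.
Qed.

(** * Long-range dependence *)

Theorem theorem3p1 (R : realType) (d : measure_display) (T : measurableType d)
    (P : probability T R) (alpha : R) (k : nat) (lam : 'I_k -> R)
    (Malpha : R -> T -> R)
    (halpha : 0 < alpha < 1) (hk : (1 <= k)%N) (hlam : forall j, 0 < lam j)
    (hM : GFCP P alpha lam Malpha) :
  LRD P Malpha.
Proof.
have [mZ [M [Y [MP YP MY ZE]]]] := hM.
have [mY [D DP YD]] := YP.
have /andP[a0 a1] := halpha.
set mu := total_rate lam * jump_moment lam 1.
set sg := total_rate lam * jump_moment lam 2.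
have mu0 : 0 < mu by rewrite mulr_gt0 ?(total_rate_gt0 hk hlam) ?(jump_moment_gt0 hk hlam).
have sg0 : 0 < sg by rewrite mulr_gt0 ?(total_rate_gt0 hk hlam) ?(jump_moment_gt0 hk hlam).
have Zmean := GFCP_mean hk hlam MP YP MY mZ ZE.
have Zmul := GFCP_mean_mul hk hlam MP YP MY mZ ZE.
rewrite -/mu in Zmean; rewrite -/mu -/sg in Zmul.
have [m1 Ym1] := inverse_mean DP mY YD ler01.
have [m2 Ym2] := inverse_square_mean DP mY YD ler01.
have [m1_gt0 m12] := inverse_variance_gt0 halpha DP mY YD Ym1 Ym2.
have v0 : 0 < m2 - m1 ^+ 2 by rewrite subr_gt0.
set v := m2 - m1 ^+ 2 in v0.
have Ymean t : 0 < t -> has_mean P (Y t) (t `^ alpha * m1).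
  by move=> t0; exact: (inverse_mean_scaling DP mY YD).
have Ysq t : 0 < t -> has_mean P (fun w => Y t w * Y t w) ((t `^ alpha) ^+ 2 * m2).
  by move=> t0; exact: (inverse_square_mean_scaling DP mY YD).
(* The variance at time [t], divided by [t ^ (2 alpha)]. *)
pose q t := sg * m1 * t `^ (- alpha) + mu ^+ 2 * v.
have var t : 0 < t -> fine 'V_P[Malpha t]%E = (t `^ alpha) ^+ 2 * q t.
  move=> t0; have t0' := ltW t0.
  have mt := Zmean t _ t0' (Ymean t t0).
  rewrite /variance (covariance_mean mt mt (Zmul t t _ _ t0' (lexx t) (Ymean t t0) (Ysq t t0))).
  rewrite /= /q powRN /v; field.
  by rewrite gt_eqF// powR_gt0.
have q_gt0 t : 0 < q t.
  rewrite ltr_wpDl//; last by rewrite mulr_gt0// exprn_gt0.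
  by rewrite mulr_ge0 ?powR_ge0// mulr_ge0// ltW.
have sd t : 0 < t -> Num.sqrt (fine 'V_P[Malpha t]%E) = t `^ alpha * Num.sqrt (q t).
  by move=> t0; rewrite var// sqrtrM ?sqr_ge0// sqrtr_sqr ger0_norm// powR_ge0.
exists alpha; split => // s s0.
have [j j0 bounds] := inverse_mul_bounds DP mY YD (ltW s0).
(* The limit of the covariance at times [s] and [t]. *)
pose L := sg * (s `^ alpha * m1) + mu ^+ 2 * j.
have L0 : 0 < L.
  apply: ltr_pwDl; last by rewrite mulr_ge0// sqr_ge0.
  by rewrite mulr_gt0// mulr_gt0// powR_gt0.
pose w := mu * Num.sqrt v.
have w0 : 0 < w by rewrite mulr_gt0// sqrtr_gt0.
have sds0 : 0 < Num.sqrt (fine 'V_P[Malpha s]%E).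
  by rewrite sd// mulr_gt0 ?powR_gt0// sqrtr_gt0.
exists (L / (Num.sqrt (fine 'V_P[Malpha s]%E) * w)).
  by rewrite divr_gt0// mulr_gt0.
pose C t := fine (covariance P (Malpha s) (Malpha t)).
(* How far the covariance may be below its limit. *)
pose e t := mu ^+ 2 * (s `^ alpha * m1) * (m1 * (s * t `^ (- (1 - alpha)))).
have Cbounds t : s < t -> L - e t <= C t <= L.
  move=> st; have t0 := lt_trans s0 st.
  have ts0 : 0 < t - s by rewrite subr_gt0.
  have [g mg] := inverse_mul_mean DP mY YD (ltW s0) (ltW t0).
  have /andP[b1 b2] := bounds t _ _ _ g (ltW st) (Ymean s s0) (Ymean t t0) (Ymean _ ts0) mg.
  rewrite /C (covariance_mean (Zmean s _ (ltW s0) (Ymean s s0))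
    (Zmean t _ (ltW t0) (Ymean t t0))
    (Zmul s t _ _ (ltW s0) (ltW st) (Ymean s s0) mg)) /=.
  have s_t : 0 < s < t by rewrite s0.
  have /andP[d1 d2] := powR_increment_le halpha s_t.
  have us0 : 0 <= s `^ alpha * m1 by rewrite mulr_ge0 ?powR_ge0// ltW.
  have d2' := ler_wpM2l us0 (ler_wpM2l (ltW m1_gt0) d2).
  have mu2 := sqr_ge0 mu.
  apply/andP; split.
    rewrite -subr_ge0 /L /e.
    rewrite [leRHS](_ : _ = mu ^+ 2 * (g - (j + s `^ alpha * m1 * ((t - s) `^ alpha * m1)) +
      (s `^ alpha * m1 * (m1 * (s * t `^ (- (1 - alpha)))) -
       s `^ alpha * m1 * (m1 * (t `^ alpha - (t - s) `^ alpha))))); last by ring.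
    by rewrite mulr_ge0// addr_ge0// subr_ge0.
  rewrite -subr_ge0 /L.
  rewrite [leRHS](_ : _ = mu ^+ 2 * (j + s `^ alpha * m1 * (t `^ alpha * m1) - g));
    last by ring.
  by rewrite mulr_ge0// subr_ge0.
have cC : C t @[t --> +oo] --> L.
  apply: (@squeeze_cvgr _ _ _ _ (fun t => L - e t) (fun=> L)); last 2 first.
  - rewrite -[X in _ --> X]subr0; apply: cvgB; first exact: cvg_cst.
    rewrite -(mulr0 (mu ^+ 2 * (s `^ alpha * m1))); apply: cvgM; first exact: cvg_cst.
    rewrite -(mulr0 m1); apply: cvgM; first exact: cvg_cst.
    rewrite -(mulr0 s); apply: cvgM; first exact: cvg_cst.
    by apply: powRN_cvg0; rewrite subr_gt0.
  - exact: cvg_cst.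
  by near=> t; apply: Cbounds; near: t; exact: nbhs_pinfty_gt (num_real s).
have cq : w / Num.sqrt (q t) @[t --> +oo] --> w / w.
  have qv : q t @[t --> +oo] --> mu ^+ 2 * v.
    rewrite -[X in _ --> X]add0r; apply: cvgD; last exact: cvg_cst.
    rewrite -(mulr0 (sg * m1)); apply: cvgM; first exact: cvg_cst.
    exact: powRN_cvg0.
  have ww : w = Num.sqrt (mu ^+ 2 * v).
    by rewrite /w sqrtrM ?sqr_ge0// sqrtr_sqr gtr0_norm.
  apply: cvgM; first exact: cvg_cst.
  apply: cvgV; first by rewrite gt_eqF.
  rewrite ww; exact: (cvg_comp _ _ qv (@sqrt_continuous R _)).
have lim1 : C t / L * (w / Num.sqrt (q t)) @[t --> +oo] --> (1 : R).
  have -> : (1 : R) = L / L * (w / w) by rewrite !divff ?mulr1// gt_eqF.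
  by apply: cvgM => //; apply: cvgM => //; exact: cvg_cst.
apply: cvg_trans lim1; apply: near_eq_cvg; near=> t.
have t0 : 0 < t by near: t; exact: nbhs_pinfty_gt.
have ta0 : 0 < t `^ alpha by rewrite powR_gt0.
have sq0 : 0 < Num.sqrt (q t) by rewrite sqrtr_gt0.
rewrite /correlation -/(C t) (sd t t0) powRN; move: sds0; set ss := Num.sqrt (fine _) => sds0.
field.
by rewrite !gt_eqF.
Unshelve. all: by end_near. Qed.
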